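(* Let $\mathcal{L}$ be a strongly elliptic operator of order $n$ on the torus $\Omega=\mathbb{T}^d$, let $\mu>0$ be such that $\mathcal{L}_\mu:=\mathcal{L}+\mu$ is admissible, with spectrum contained in the interior of the sector $\Sigma_\delta$, and let $\{(\lambda_k,\phi_k)\}_{k\ge1}$ be the eigenpairs of $\mathcal{L}_\mu$. Let $u_0\in L^2(\Omega)$ have an expansion $u_0=\sum_{k\ge1}c_k\phi_k$ whose coefficients satisfy $|c_k|\le\theta k^{-\gamma}$ for all $k\ge 1$, for some $\theta>0$ and $\gamma>1$, and let $$u(x,t)=e^{\mu t}\sum_{k=1}^\infty c_k e^{-\lambda_k t}\phi_k(x)$$ be the solution of $\partial_t u=-\mathcal{L}u$ on $\Omega\times[0,T]$ with $u(\cdot,0)=u_0$. Then for all sufficiently small $\varepsilon>0$ there exists a linear space $V\subset L^2(\Omega)$ of dimension at most $C_{\mathcal{L}}(\kappa)|\log\varepsilon|^2$ such that $$\|u(\cdot,t)-P_Vu(\cdot,t)\|_{L^2(\Omega)}\le C\,\varepsilon\,\|u_0\|_{L^2(\Omega)}\qquad\text{for all }t\in[0,T],$$ where $P_V$ is the projection onto $V$, $C=C(\theta,\gamma)$, and $\kappa=\mathcal{O}(\beta/(\gamma-1))$ with $\beta=n/d$.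
   Context: $\Omega=\mathbb{T}^d=\mathbb{R}^d/(2\pi\mathbb{Z})^d$. $\mathcal{L}f(x)=\sum_{|\alpha|=0}^n p_\alpha(x)\partial^\alpha f(x)$ is a time-independent linear differential operator whose coefficients $p_\alpha$ are real-valued periodic functions, regular enough for standard elliptic theory. Strongly elliptic of order $n=2m$ means there is $\nu>0$ with $(-1)^{n/2}\sum_{|\alpha|=n}p_\alpha(x)\xi^\alpha\ge\nu|\xi|^n$ for all $x\in\overline\Omega$, $\xi\in\mathbb{Z}^d$. For $\delta\in(0,\pi/2)$, $\Sigma_\delta=\{z\in\mathbb{C}:|\arg z|\le\delta\}$. A linear, densely defined, closed operator $\mathcal{A}$ on a Banach space $X$ is admissible if there is $M>0$ with $\|(z-\mathcal{A})^{-1}\|_{X\to X}\le \frac{M}{1+|z|}$ for all $z\in\mathbb{C}\setminus\Sigma_\delta$. Here $X=L^2(\Omega)$. The eigenpairs $\{(\lambda_k,\phi_k)\}_{k\ge1}$ of $\mathcal{L}_\mu$ are sorted by $\Re\lambda_k$ in ascending order including multiplicity, with eigenfunctions normalized in $L^2(\Omega)$; the eigenvalues have the growth rate $\Re\lambda_k=\mathcal{O}(k^{\beta})$, $\beta=n/d$. The constant $C_{\mathcal{L}}(\kappa)>0$ depends on $\mathcal{L}$ and $\kappa$ and is chosen from the following approximation property of an admissible operator $\mathcal{A}$ (used with $\mathcal{A}=\mathcal{L}_\mu$): for $\kappa>0$, $t_0=\varepsilon^\kappa$ and $N=C_{\mathcal{A}}(\kappa)|\log\varepsilon|^2$ there is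 an operator of the form $\mathcal{A}_N(t)=\sum_{k=-N}^N b_ke^{-z_kt}(z_k-\mathcal{A})^{-1}$ with constants $b_k,z_k\in\mathbb{C}$ such that $\|e^{-\mathcal{A}t}-\mathcal{A}_N(t)\|_{X\to X}\le\varepsilon$ for all $t\in[t_0,T]$. *)

(* Defs.v *)
From HB Require Import structures.
From mathcomp Require Import all_boot all_order all_algebra.
From mathcomp Require Import all_classical all_reals all_analysis.

Set Implicit Arguments.
Unset Strict Implicit.
Unset Printing Implicit Defensive.
Import Order.TTheory GRing.Theory Num.Theory.
Import numFieldNormedType.Exports.
From mathcomp Require Import complex.
Local Open Scope classical_set_scope.
Local Open Scope ring_scope.
Local Open Scope complex_scope.

Notation Cabs := ComplexField.Normc.normc.

Definition cexp (R : realType) (z : R[i]) : R[i] :=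
  (expR (Re z) * cos (Im z)) +i* (expR (Re z) * sin (Im z)).

(* The closed sector |arg z| <= delta, in polar form; it contains 0. *)
Definition sector (R : realType) (delta : R) : set R[i] :=
  [set z | exists r a : R, [/\ 0 <= r, `|a| <= delta &
                              z = (r * cos a) +i* (r * sin a)]].

Definition Cinterior (R : realType) (S : set R[i]) : set R[i] :=
  [set z | exists2 r : R, 0 < r & forall w, Cabs (w - z) < r -> S w].

Section TorusMeasure.
Variable R : realType.

Definition cons_tuple (d : nat) (y : d.-tuple R * R) : d.+1.-tuple R :=
  [the d.+1.-tuple R of y.2 :: y.1].

Lemma measurable_cons_tuple (d : nat) :
  measurable_fun [set: d.-tuple R * R] (@cons_tuple d).
Proof. by apply: measurable_cons. Qed.

Definition lebesgue_cons (d : nat) (m : {measure set (d.-tuple R) -> \bar R}) :=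
  pushforward (m \x (@lebesgue_measure R))%E (@cons_tuple d).

HB.instance Definition _ d (m : {measure set (d.-tuple R) -> \bar R}) :=
  Measure.copy (lebesgue_cons m)
    (measure_function_pushforward__canonical__measure_function_Measure
       (m \x (@lebesgue_measure R))%E (@measurable_cons_tuple d)).

(* Lebesgue measure on R^d, as an iterated product measure. *)
Fixpoint lebesgueN (d : nat) : {measure set (d.-tuple R) -> \bar R} :=
  if d is d'.+1 then lebesgue_cons (lebesgueN d') else dirac [tuple].

Definition cell (d : nat) : set (d.-tuple R) :=
  [set x | forall i, 0 <= tnth x i < pi *+ 2].

Lemma measurable_cell (d : nat) : measurable (@cell d).
Proof.
rewrite (_ : @cell d = \bigcap_(i in [set: 'I_d])
   ((@tnth d R)^~ i @^-1` `[0, (pi *+ 2)[%classic)).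
  apply: fin_bigcap_measurable => // i _.
  by rewrite -[X in measurable X]setTI; apply: measurable_tnth.
apply/seteqP; split=> [x h i _|x h i] /=.
  by rewrite in_itv /=; exact: h.
by have := h i Logic.I; rewrite /= in_itv.
Qed.

(* The measure dx of T^d = R^d / (2 pi Z)^d, carried by the fundamental cell
   [0, 2 pi)^d.  A function on T^d is represented by a function on R^d; two
   functions which agree almost everywhere on the cell represent the same
   class. *)
Definition torus_measure (d : nat) : {measure set (d.-tuple R) -> \bar R} :=
  mrestr (lebesgueN d) (@measurable_cell d).

End TorusMeasure.

Notation tfun R d := (d.-tuple R -> R[i]).

Section L2.
Variables (R : realType) (d : nat).
Local Notation mu := (torus_measure R d).
Local Notation F := (tfun R d).

Definition L2 : set F :=
  [set f | (fun x => Re (f x)) \in Lfun mu 2%:E /\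
           (fun x => Im (f x)) \in Lfun mu 2%:E].

(* Only meaningful on L2: [fine] sends an infinite norm to 0. *)
Definition L2norm (f : F) : R := fine (Lnorm mu 2%:E (fun x => (Cabs (f x))%:E)).

Definition aeq (f g : F) : Prop := {ae mu, forall x, f x = g x}.

Definition Cint (f : F) : R[i] :=
  (\int[mu]_x Re (f x)) +i* (\int[mu]_x Im (f x)).

Definition inner (f g : F) : R[i] := Cint (fun x => f x * (g x)^*).

Definition L2cvg (fN : nat -> F) (f : F) : Prop :=
  (fun N => L2norm (fun x => fN N x - f x)) @ \oo --> (0 : R).

Definition L2span (m : nat) (v : 'I_m -> F) : set F :=
  [set f | L2 f /\
     exists a : 'I_m -> R[i], aeq f (fun x => \sum_(i < m) a i * v i x)].

Definition subspace_dim_le (V : set F) (r : R) : Prop :=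
  exists (m : nat) (v : 'I_m -> F),
    [/\ m%:R <= r, forall i, L2 (v i) & V = L2span v].

Definition orthogonal_projection (V : set F) (P : F -> F) : Prop :=
  forall f, L2 f ->
    V (P f) /\ forall w, V w -> inner (fun x => f x - P f x) w = 0.

End L2.

(* An unbounded operator A on L^2(T^d) is given by its graph: [A f g] means
   that f is in the domain of A and A f = g. *)
Section Operators.
Variables (R : realType) (d : nat).
Local Notation F := (tfun R d).
Local Notation op := (F -> F -> Prop).

(* The second clause lets A act on classes modulo a.e. equality. *)
Definition linear_operator (A : op) : Prop :=
  [/\ forall f g, A f g -> L2 f /\ L2 g,
      forall f g f' g', A f g -> L2 f' -> L2 g' ->
        aeq f f' -> aeq g g' -> A f' g',
      forall f g g', A f g -> A f g' -> aeq g g' &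
      forall (a : R[i]) f g f' g', A f g -> A f' g' ->
        A (fun x => a * f x + f' x) (fun x => a * g x + g' x)].

Definition densely_defined (A : op) : Prop :=
  forall f (e : R), L2 f -> 0 < e ->
    exists f' g', A f' g' /\ L2norm (fun x => f x - f' x) < e.

Definition closed_operator (A : op) : Prop :=
  forall (fN gN : nat -> F) f g, L2 f -> L2 g ->
    (forall N, A (fN N) (gN N)) -> L2cvg fN f -> L2cvg gN g -> A f g.

(* f = (z - A)^{-1} g *)
Definition resolvent (A : op) (z : R[i]) (g f : F) : Prop :=
  A f (fun x => z * f x - g x).

Definition resolvent_set (A : op) : set R[i] :=
  [set z | [/\ forall g, L2 g -> exists f, resolvent A z g f,
               forall g f f', L2 g -> resolvent A z g f ->
                 resolvent A z g f' -> aeq f f' &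
               exists K : R, forall g f, L2 g -> resolvent A z g f ->
                 L2norm f <= K * L2norm g]].

Definition spectrum (A : op) : set R[i] := ~` resolvent_set A.

Definition admissible (delta : R) (A : op) : Prop :=
  [/\ linear_operator A, densely_defined A, closed_operator A &
      exists2 M : R, 0 < M &
        forall z, ~ sector delta z -> resolvent_set A z /\
          forall g f, L2 g -> resolvent A z g f ->
            L2norm f <= M / (1 + Cabs z) * L2norm g].

(* A + mu *)
Definition plus_scalar (A : op) (mu : R) : op :=
  fun f g => A f (fun x => g x - mu%:C * f x).

Definition bounded_linear (S : F -> F) : Prop :=
  [/\ forall f, L2 f -> L2 (S f),
      forall (a : R[i]) f g, L2 f -> L2 g ->
        aeq (S (fun x => a * f x + g x)) (fun x => a * S f x + S g x) &
      exists K : R, forall f, L2 f -> L2norm (S f) <= K * L2norm f].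

(* S t = e^{- A t}: S is the strongly continuous semigroup generated by -A *)
Definition semigroup_of (A : op) (S : R -> F -> F) : Prop :=
  [/\ forall t, 0 <= t -> bounded_linear (S t),
      forall f, L2 f -> aeq (S 0 f) f,
      forall s t f, 0 <= s -> 0 <= t -> L2 f ->
        aeq (S (s + t) f) (S s (S t f)),
      forall f, L2 f ->
        (fun t : R => L2norm (fun x => S t f x - f x)) @ 0^'+ --> (0 : R) &
      forall f g, A f g <->
        [/\ L2 f, L2 g &
          (fun t : R => L2norm (fun x => (t^-1)%:C * (f x - S t f x) - g x))
            @ 0^'+ --> (0 : R)]].

(* The constant C realises, for this kappa, the approximation of e^{- A t} on
   [eps^kappa, T] by a sum over -N <= k <= N of resolvents, where
   N = C |log eps|^2 (rounded up). *)
Definition approximation_property (A : op) (T kap C : R) : Prop :=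
  forall S, semigroup_of A S ->
  exists2 eps0 : R, 0 < eps0 & forall eps : R, 0 < eps < eps0 ->
    let N := `|Num.ceil (C * `|ln eps| ^+ 2)|%N in
    exists b z : int -> R[i],
      (forall k : int, (`|k| <= N)%N -> resolvent_set A (z k)) /\
      forall (t : R) (f : F) (w : int -> F),
        eps `^ kap <= t <= T -> L2 f ->
        (forall k : int, (`|k| <= N)%N -> resolvent A (z k) f (w k)) ->
        L2norm (fun x => S t f x -
          \sum_(j < (N.*2).+1)
             (let k := (j%:Z - N%:Z)%R in
              b k * cexp (- z k * t%:C) * w k x))
        <= eps * L2norm f.

(* The eigenpairs (lam k, phi k), listed from k = 0, of A: normalised, sorted
   by real part, and such that for each z the family of the phi k with
   lam k = z is a basis of the eigenspace ker (z - A), so that an eigenvalue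
   is repeated according to the dimension of its eigenspace. *)
Definition eigenpairs (A : op) (lam : nat -> R[i]) (phi : nat -> F) : Prop :=
  [/\ forall k, A (phi k) (fun x => lam k * phi k x) /\ L2norm (phi k) = 1,
      forall k, Re (lam k) <= Re (lam k.+1),
      forall z f, A f (fun x => z * f x) ->
        exists (m : nat) (a : nat -> R[i]),
          aeq f (fun x => \sum_(k < m | lam k == z) a k * phi k x) &
      forall z (m : nat) (a : nat -> R[i]),
        aeq (fun x => \sum_(k < m | lam k == z) a k * phi k x) (fun=> 0) ->
        forall k, (k < m)%N -> lam k = z -> a k = 0].

(* du/dt = - A u in L^2, with u(0) = u0 *)
Definition solution (A : op) (T : R) (u0 : F) (u : R -> F) : Prop :=
  [/\ aeq (u 0) u0,
      forall t, 0 <= t <= T -> L2 (u t),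
      forall t, 0 <= t <= T -> forall e : R, 0 < e ->
        exists2 r : R, 0 < r & forall s, 0 <= s <= T -> `|s - t| < r ->
          L2norm (fun x => u s x - u t x) < e &
      forall t, 0 < t < T -> exists2 g, A (u t) g &
        (fun h : R => L2norm (fun x => (h^-1)%:C * (u (t + h) x - u t x) + g x))
          @ 0^' --> (0 : R)].

End Operators.

Section DifferentialOperators.
Variables (R : realType) (d : nat).
Local Notation F := (tfun R d).

(* The bound alpha i <= n carried by the type follows from |alpha| <= n. *)
Definition mindex (n : nat) : Type :=
  {a : {ffun 'I_d -> 'I_n.+1} | (\sum_i a i <= n)%N}.

Definition morder (n : nat) (a : mindex n) : nat := (\sum_i val a i)%N.

Definition mmonomial (n : nat) (xi : 'I_d -> R) (a : mindex n) : R :=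
  \prod_i xi i ^+ val a i.

Definition rowvec (x : d.-tuple R) : 'rV[R]_d := \row_i tnth x i.

Definition periodic2pi (f : 'rV[R]_d -> R) : Prop :=
  forall (i : 'I_d) x, f (x + (pi *+ 2) *: delta_mx 0 i) = f x.

Definition partials (s : seq 'I_d) (f : 'rV[R]_d -> R) : 'rV[R]_d -> R :=
  foldr (fun i g => fun x => 'D_(delta_mx 0 i) g x) f s.

Definition mpartial (n : nat) (a : mindex n) : ('rV[R]_d -> R) -> _ :=
  partials (flatten [seq nseq (val a i) i | i <- enum 'I_d]).

Definition smooth (f : 'rV[R]_d -> R) : Prop :=
  forall s : seq 'I_d, continuous (partials s f) /\
    forall i x, derivable (partials s f) x (delta_mx 0 i).

(* The test functions are the smooth periodic ones, so that this is the weak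
   derivative on the torus and not merely on the open cell. *)
Definition weak_derivative (n : nat) (a : mindex n) (f g : F) : Prop :=
  forall psi : 'rV[R]_d -> R, smooth psi -> periodic2pi psi ->
    Cint (fun x => f x * (mpartial a psi (rowvec x))%:C) =
    (-1) ^+ morder a * Cint (fun x => g x * (psi (rowvec x))%:C).

(* The L^2 realisation of f |-> sum_{|a| <= n} p_a D^a f, with domain the
   Sobolev space H^n(T^d). *)
Definition diffop (n : nat) (p : mindex n -> 'rV[R]_d -> R) (f g : F) : Prop :=
  [/\ L2 f, L2 g &
      exists D : mindex n -> F,
        (forall a, L2 (D a) /\ weak_derivative a f (D a)) /\
        aeq g (fun x => \sum_a (p a (rowvec x))%:C * D a x)].

Definition strongly_elliptic (n : nat) (p : mindex n -> 'rV[R]_d -> R) : Prop :=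
  exists2 nu : R, 0 < nu & forall (x : 'rV[R]_d) (xi : 'I_d -> int),
    nu * Num.sqrt (\sum_i ((xi i)%:~R : R) ^+ 2) ^+ n <=
    (-1) ^+ n./2 * \sum_(a : mindex n | morder a == n)
                      p a x * mmonomial (fun i => (xi i)%:~R) a.

End DifferentialOperators.

(* Main.v *)
Require Import Defs.
From mathcomp Require Import all_boot all_order all_algebra.
From mathcomp Require Import all_classical all_reals all_analysis.
Set Implicit Arguments.
Unset Strict Implicit.
Unset Printing Implicit Defensive.
Import Order.TTheory GRing.Theory Num.Theory.
Import numFieldNormedType.Exports.
From mathcomp Require Import complex.
From mathcomp Require Import zify ring lra.
Local Open Scope classical_set_scope.
Local Open Scope ring_scope.
Local Open Scope complex_scope.

(** The solution is an absolutely convergent series of normalised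
eigenfunctions, since [|c_k| <= theta k^(- gamma)] with [gamma > 1]. A uniform
approximation, over the spectrum, of the scalar functions
[t |-> exp (- lambda t)] by a sum of few products [g_i t * h_i lambda] hence
yields an approximation of the solution by [sum_i g_i t * v_i] with
[v_i = sum_k c_k h_i (lambda_k) phi_k]. The eigenfunctions need not be
orthogonal: by the triangle inequality, the error is governed by
[sum_k |c_k|].

The eigenvalues lie in the sector, where [Re lambda] controls [|lambda|]. On a
window [[s, (1 + q) s]] with [q] small compared with [cos delta], the Taylor
expansion of [exp (- lambda t)] at [s] therefore converges geometrically,
uniformly in [lambda] ([cexp_window]): the growth of the remainder is absorbed
by [exp (- s Re lambda)]. Starting from [t0 = eps^(2 + 4 kappa)], O(|ln eps|)
such windows reach [T], and O(|ln eps|) Taylor coefficients on each of them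
give the accuracy [eps^2]; the dimension is O(|ln eps|^2) with a factor which
depends on [kappa] and [delta] only ([low_rank_approximation]). On [[0, t0]]
the initial value is used: the growth [|lambda_k| = O(k^beta)] and the decay of
the coefficients make the solution Hoelder continuous at [t = 0] with exponent
[1 / (1 + 2 kappa)], where [kappa = beta / (gamma - 1)]
([initial_layer_sum]).

Replacing a constant of the resolvent approximation property by a larger one
preserves that property ([approximation_property_le]), so that [CL kappa] may be
taken to dominate the factor found above. The orthogonal projection realises
the best approximation from the span ([exists_orthogonal_projection]), and the
spare factor [eps] absorbs all constants when the initial value is not null. If
it is null, the solution vanishes: its implicit Euler approximations are images
of the null initial value under bounded products of resolvents, and they
converge to the solution ([null_initial_value]). *)

(** * Square-integrable functions on the torus *)

Section L2Space.
Context {R : realType} {d : nat}.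
Local Notation mu := (torus_measure R d).
Local Notation F := (tfun R d).

(** The real part of [inner]: bilinear rather than sesquilinear, it carries the
Euclidean geometry, and [inner f g] is recovered as
[dotp f g + i dotp f (i g)]. *)
Definition dotp (f g : F) : R :=
  \int[mu]_x (Re (f x) * Re (g x) + Im (f x) * Im (g x)).

Lemma L2D (f g : F) : L2 f -> L2 g -> L2 (fun x => f x + g x).
Proof.
move=> [f1 f2] [g1 g2]; split.
  rewrite (_ : (fun x => _) = (fun x => Re (f x)) + (fun x => Re (g x))).
    exact: (Lfun_addr_closed mu (lee1n 2)).2.
  by apply/funext => x; rewrite /= fctE; case: (f x) (g x) => [? ?] [].
rewrite (_ : (fun x => _) = (fun x => Im (f x)) + (fun x => Im (g x))).
  exact: (Lfun_addr_closed mu (lee1n 2)).2.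
by apply/funext => x; rewrite /= fctE; case: (f x) (g x) => [? ?] [].
Qed.

Lemma L2Z (a : R[i]) (f : F) : L2 f -> L2 (fun x => a * f x).
Proof.
case: a => a b [f1 f2].
have sc r (g : d.-tuple R -> R) : g \in Lfun mu 2%:E -> r \o* g \in Lfun mu 2%:E.
  by apply: Lfun_scale; rewrite ler1n.
split.
  rewrite (_ : (fun x => _) = (a \o* (fun x => Re (f x))) +
                              ((- b) \o* (fun x => Im (f x)))).
    by apply: (Lfun_addr_closed mu (lee1n 2)).2; exact: sc.
  by apply/funext => x; rewrite /= fctE /=; case: (f x) => u v /=; ring.
rewrite (_ : (fun x => _) = (a \o* (fun x => Im (f x))) +
                            (b \o* (fun x => Re (f x)))).
  by apply: (Lfun_addr_closed mu (lee1n 2)).2; exact: sc.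
by apply/funext => x; rewrite /= fctE /=; case: (f x) => u v /=; ring.
Qed.

Lemma L2_0 : L2 ((fun=> 0) : F).
Proof.
by split; exact: (Lfun_addr_closed mu (lee1n 2)).1.
Qed.

Lemma L2_sum (I : Type) (r : seq I) (P : pred I) (f : I -> F) :
  (forall i, L2 (f i)) -> L2 (fun x => \sum_(i <- r | P i) f i x).
Proof.
move=> fL2; elim: r => [|i r IH].
  by under eq_fun do rewrite big_nil; exact: L2_0.
under eq_fun do rewrite big_cons.
by case: (P i) => //; apply: L2D.
Qed.

Lemma L2N (f : F) : L2 f -> L2 (fun x => - f x).
Proof. by move=> /(L2Z (-1)); under eq_fun do rewrite mulN1r. Qed.

Lemma L2B (f g : F) : L2 f -> L2 g -> L2 (fun x => f x - g x).
Proof. by move=> ? ?; apply: L2D => //; exact: L2N. Qed.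

Let int2 (f g : d.-tuple R -> R) : f \in Lfun mu 2%:E -> g \in Lfun mu 2%:E ->
  mu.-integrable setT (EFin \o (fun x => f x * g x)).
Proof. by move=> ? ?; apply/Lfun1_integrable/Lfun2_mul_Lfun1. Qed.

Lemma dotp_integrable (f g : F) : L2 f -> L2 g ->
  mu.-integrable setT
    (EFin \o (fun x => Re (f x) * Re (g x) + Im (f x) * Im (g x))).
Proof.
move=> [f1 f2] [g1 g2].
have -> : EFin \o (fun x => Re (f x) * Re (g x) + Im (f x) * Im (g x)) =
  ((EFin \o (fun x => Re (f x) * Re (g x))%R) \+
   (EFin \o (fun x => Im (f x) * Im (g x))%R))%E by apply/funext.
by apply: integrableD => //; exact: int2.
Qed.

Lemma dotpC (f g : F) : dotp f g = dotp g f.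
Proof. by apply: eq_Rintegral => x _; ring. Qed.

Lemma dotpDl (f g h : F) : L2 f -> L2 g -> L2 h ->
  dotp (fun x => f x + g x) h = dotp f h + dotp g h.
Proof.
move=> fL gL hL; rewrite /dotp -RintegralD//; try exact: dotp_integrable.
apply: eq_Rintegral => x _ /=.
by case: (f x) (g x) (h x) => [? ?] [? ?] [? ?] /=; ring.
Qed.

Lemma dotpZl (a : R) (f h : F) : L2 f -> L2 h ->
  dotp (fun x => a%:C * f x) h = a * dotp f h.
Proof.
move=> fL hL; rewrite /dotp -RintegralZl//; try exact: dotp_integrable.
apply: eq_Rintegral => x _ /=.
by case: (f x) (h x) => [? ?] [? ?] /=; ring.
Qed.

Lemma dotp0l (h : F) : dotp (fun=> 0) h = 0.
Proof.
rewrite /dotp (_ : (fun x => _) = cst 0); last first.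
  by apply/funext => x; rewrite !mul0r addr0.
by rewrite Rintegral_cst// mul0r.
Qed.

Lemma dotpDr (f g h : F) : L2 f -> L2 g -> L2 h ->
  dotp h (fun x => f x + g x) = dotp h f + dotp h g.
Proof. by move=> *; rewrite dotpC dotpDl// !(dotpC h). Qed.

Lemma dotpZr (a : R) (f h : F) : L2 f -> L2 h ->
  dotp h (fun x => a%:C * f x) = a * dotp h f.
Proof. by move=> *; rewrite dotpC dotpZl// (dotpC h). Qed.

Lemma dotp_ge0 (f : F) : 0 <= dotp f f.
Proof. by apply: Rintegral_ge0 => x _; rewrite -!expr2 addr_ge0// sqr_ge0. Qed.

Lemma L2normE (f : F) : L2 f -> L2norm f = Num.sqrt (dotp f f).
Proof.
move=> fL; rewrite /L2norm unlock /Lnorm.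
under eq_integral => x _.
  rewrite /= (_ : `|Cabs (f x)| `^ 2 =
    Re (f x) * Re (f x) + Im (f x) * Im (f x)); last first.
    rewrite powR_mulrn ?normr_ge0// real_normK ?num_real//.
    by case: (f x) => u v /=; rewrite sqr_sqrtr ?addr_ge0 ?sqr_ge0// !expr2.
  over.
have /integrable_fin_num -/(_ measurableT) fin := dotp_integrable fL fL.
by rewrite -(fineK fin) poweR_EFin /= powR12_sqrt// dotp_ge0.
Qed.

Lemma L2norm_ge0 (f : F) : 0 <= L2norm f.
Proof. by apply: fine_ge0; exact: Lnorm_ge0. Qed.

Lemma sqr_L2norm (f : F) : L2 f -> L2norm f ^+ 2 = dotp f f.
Proof. by move=> fL; rewrite L2normE// sqr_sqrtr// dotp_ge0. Qed.

Lemma L2normZ (a : R[i]) (f : F) : L2 f ->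
  L2norm (fun x => a * f x) = Cabs a * L2norm f.
Proof.
move=> fL; apply/eqP; rewrite -(@eqrXn2 _ 2)//; last 2 first.
- exact: L2norm_ge0.
- by rewrite mulr_ge0 ?L2norm_ge0//; case: (a) => ? ?; exact: sqrtr_ge0.
rewrite sqr_L2norm ?exprMn; last exact: L2Z.
rewrite sqr_L2norm// /dotp -RintegralZl//; last exact: dotp_integrable.
apply/eqP; apply: eq_Rintegral => x _ /=.
case: a (f x) => [u v] [w z] /=.
by rewrite sqr_sqrtr ?addr_ge0 ?sqr_ge0//; ring.
Qed.

Lemma aeq0_L2norm (f : F) : L2 f -> aeq f (fun=> 0) -> L2norm f = 0.
Proof.
move=> fL f0; rewrite L2normE//.
suff -> : dotp f f = 0 by rewrite sqrtr0.
rewrite /dotp /Rintegral.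
rewrite (@ae_eq_integral _ _ _ _ setT (cst 0%E))//.
- by rewrite integral0.
- by case/integrableP : (dotp_integrable fL fL).
- apply: filterS f0 => x fx _ /=.
  by rewrite fx /= !mul0r addr0.
Qed.

(** Cauchy-Schwarz. The form is only semidefinite on functions, so that null
norms need another combination than the usual [|g| f - |f| g]. *)
Lemma dotp_le (f g : F) : L2 f -> L2 g -> dotp f g <= L2norm f * L2norm g.
Proof.
move=> fL gL.
have quad (s t : R) :
    0 <= s ^+ 2 * dotp f f + s * t * dotp f g *+ 2 + t ^+ 2 * dotp g g.
  have := dotp_ge0 (fun x => s%:C * f x + t%:C * g x).
  have sf := L2Z s%:C fL; have tg := L2Z t%:C gL.
  rewrite dotpDl// ?dotpDr//; try exact: L2D.
  rewrite !dotpZl// !dotpZr// (dotpC g f).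
  congr (0 <= _); ring.
rewrite -!sqr_L2norm// in quad.
have := L2norm_ge0 f; have := L2norm_ge0 g.
set a := L2norm f in quad *; set b := L2norm g in quad *; move=> b0 a0.
set B := dotp f g in quad *.
have [ab0|] := ltP 0 (a * b).
  have := quad b (- a).
  rewrite (_ : _ + _ = (a * b) * (a * b - B) *+ 2); last by ring.
  by rewrite pmulrn_lge0// pmulr_rge0// subr_ge0.
move=> ab0; have {}ab0 : a * b = 0 by apply/le_anti; rewrite ab0 mulr_ge0.
rewrite ab0 leNgt; apply/negP => B0.
have /eqP := ab0; rewrite mulf_eq0 => /orP[] /eqP z0.
  have := quad (- (b ^+ 2 + 1) / B) 1.
  rewrite z0 expr0n/= mulr0 add0r mulr1 divfK ?gt_eqF// expr1n mul1r.
  have := sqr_ge0 b; lra.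
have := quad 1 (- (a ^+ 2 + 1) / B).
rewrite z0 expr0n/= mulr0 addr0 mul1r divfK ?gt_eqF// expr1n mul1r.
have := sqr_ge0 a; lra.
Qed.

Lemma dotp_eq0 (f g : F) : L2 f -> L2 g -> L2norm g = 0 -> dotp f g = 0.
Proof.
move=> fL gL g0; apply/le_anti/andP; split.
  by have := dotp_le fL gL; rewrite g0 mulr0.
have := dotp_le (L2Z (- 1)%:C fL) gL.
by rewrite g0 mulr0 dotpZl// mulN1r oppr_le0.
Qed.

Lemma L2norm_triangle (f g : F) : L2 f -> L2 g ->
  L2norm (fun x => f x + g x) <= L2norm f + L2norm g.
Proof.
move=> fL gL; have fgL := L2D fL gL.
rewrite -(@ler_pXn2r _ 2)// ?nnegrE ?addr_ge0 ?L2norm_ge0//.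
rewrite sqr_L2norm// dotpDl// !dotpDr// (dotpC g f) sqrrD !sqr_L2norm//.
have := dotp_le fL gL; lra.
Qed.

Lemma L2normN (f : F) : L2 f -> L2norm (fun x => - f x) = L2norm f.
Proof.
move=> fL; rewrite (_ : (fun x => _) = (fun x => (-1) * f x)); last first.
  by apply/funext => x; rewrite mulN1r.
by rewrite L2normZ// normcN ComplexField.Normc.normc1 mul1r.
Qed.

Lemma L2normB_triangle (f g h : F) : L2 f -> L2 g -> L2 h ->
  L2norm (fun x => f x - h x) <=
  L2norm (fun x => f x - g x) + L2norm (fun x => g x - h x).
Proof.
move=> fL gL hL; have := L2norm_triangle (L2B fL gL) (L2B gL hL).
by under eq_fun do rewrite addrA subrK.
Qed.

Lemma L2norm0 : L2norm ((fun=> 0) : F) = 0.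
Proof. by rewrite L2normE ?dotp0l ?sqrtr0//; exact: L2_0. Qed.

Lemma L2norm_sum (I : Type) (r : seq I) (P : pred I) (a : I -> R[i])
    (f : I -> F) : (forall i, L2 (f i)) -> (forall i, L2norm (f i) <= 1) ->
  L2norm (fun x => \sum_(i <- r | P i) a i * f i x) <=
  \sum_(i <- r | P i) Cabs (a i).
Proof.
move=> fL f1; elim: r => [|i r IH].
  by rewrite big_nil; under eq_fun do rewrite big_nil; rewrite L2norm0.
rewrite big_cons; under eq_fun do rewrite big_cons.
case: (P i) => //; apply: le_trans (L2norm_triangle _ _) _.
- exact: L2Z.
- by apply: L2_sum => j; exact: L2Z.
rewrite lerD// L2normZ// ler_piMr//.
by case: (a i) => ? ?; exact: sqrtr_ge0.
Qed.

(** * Orthogonal projection onto a finite-dimensional span *)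

Lemma innerE (f g : F) : inner f g = dotp f g +i* dotp f (fun x => 'i * g x).
Proof.
rewrite /inner /Cint /dotp; congr (_ +i* _); apply: eq_Rintegral => x _ /=;
  by case: (f x) (g x) => [? ?] [? ?] /=; ring.
Qed.

Lemma innerDl (f g h : F) : L2 f -> L2 g -> L2 h ->
  inner (fun x => f x + g x) h = inner f h + inner g h.
Proof. by move=> *; rewrite !innerE !dotpDl//; exact: L2Z. Qed.

Lemma innerDr (f g h : F) : L2 f -> L2 g -> L2 h ->
  inner h (fun x => f x + g x) = inner h f + inner h g.
Proof.
move=> *; rewrite !innerE !dotpDr//; congr (_ +i* _).
by under eq_fun do rewrite mulrDr; rewrite dotpDr//; exact: L2Z.
Qed.

Lemma innerC (f g : F) : L2 f -> L2 g -> inner g f = (inner f g)^*.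
Proof.
move=> fL gL; rewrite !innerE /= dotpC; congr (_ +i* _).
rewrite -mulN1r /dotp -RintegralZl//; last exact/dotp_integrable/L2Z.
by apply: eq_Rintegral => x _ /=; case: (f x) (g x) => [? ?] [? ?] /=; ring.
Qed.

Lemma innerZl (a : R[i]) (f h : F) : L2 f -> L2 h ->
  inner (fun x => a * f x) h = a * inner f h.
Proof.
move=> fL hL; have ihL := L2Z 'i hL.
case: a => u v.
have -> : (fun x => (u +i* v) * f x) =
    (fun x => u%:C * f x + v%:C * ('i * f x)).
  by apply/funext => x; case: (f x) => ? ?; simpc; congr (_ +i* _); ring.
have ifL := L2Z 'i fL.
rewrite innerDl//; try exact: L2Z.
rewrite !innerE !dotpZl//.
have -> : dotp (fun x => 'i * f x) h = - dotp f (fun x => 'i * h x).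
  rewrite -mulN1r /dotp -RintegralZl//; last exact/dotp_integrable/L2Z.
  by apply: eq_Rintegral => x _ /=; case: (f x) (h x) => [? ?] [? ?] /=; ring.
have -> : dotp (fun x => 'i * f x) (fun x => 'i * h x) = dotp f h.
  by apply: eq_Rintegral => x _ /=; case: (f x) (h x) => [? ?] [? ?] /=; ring.
by simpc; congr (_ +i* _); ring.
Qed.

Lemma innerZr (a : R[i]) (f h : F) : L2 f -> L2 h ->
  inner h (fun x => a * f x) = a^* * inner h f.
Proof.
move=> fL hL; rewrite innerC//; last exact: L2Z.
by rewrite innerZl// [in RHS](innerC fL hL); exact: rmorphM.
Qed.

Lemma inner_null (f g : F) : L2 f -> L2 g -> L2norm g = 0 -> inner f g = 0.
Proof.
move=> fL gL g0; rewrite innerE !dotp_eq0//; first exact: L2Z.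
by rewrite L2normZ// g0 mulr0.
Qed.

Lemma inner_sumr (I : Type) (r : seq I) (P : pred I) (a : I -> R[i])
    (v : I -> F) (g : F) : (forall i, L2 (v i)) -> L2 g ->
  inner g (fun x => \sum_(i <- r | P i) a i * v i x) =
  \sum_(i <- r | P i) (a i)^* * inner g (v i).
Proof.
move=> vL gL; elim: r => [|i r IH].
  rewrite big_nil; under eq_fun do rewrite big_nil.
  by rewrite inner_null//; [exact: L2_0 | exact: L2norm0].
rewrite big_cons; under eq_fun do rewrite big_cons.
case: (P i) => //; rewrite innerDr ?innerZr ?IH//; first exact: L2Z.
by apply: L2_sum => j; exact: L2Z.
Qed.

(** Gram-Schmidt, without a basis: the family may be dependent, and the new
direction [e] of a step may be null. *)
Lemma exists_projection (v : nat -> F) (p : nat) (f : F) :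
    (forall i, L2 (v i)) -> L2 f ->
  exists a : nat -> R[i], forall j, (j < p)%N ->
    inner (fun x => f x - \sum_(i < p) a i * v i x) (v j) = 0.
Proof.
move=> vL; elim: p f => [f _|p IH f fL]; first by exists (fun=> 0).
have sL (c : nat -> R[i]) : L2 (fun x => \sum_(i < p) c i * v i x).
  by apply: L2_sum => i; exact: L2Z.
have [a aP] := IH f fL; have [c cP] := IH (v p) (vL p).
pose g x := f x - \sum_(i < p) a i * v i x.
pose e x := v p x - \sum_(i < p) c i * v i x.
have gL : L2 g by apply: L2B.
have eL : L2 e by apply: L2B.
pose t := inner g e / inner e e.
have te : inner (fun x => g x - t * e x) e = 0.
  rewrite (_ : (fun x => _) = (fun x => g x + (- t) * e x)); last first.
    by apply/funext => x; rewrite mulNr.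
  rewrite innerDl ?innerZl//; last exact: L2Z.
  (* a null [e] has [t = 0], by division by zero, and is orthogonal to [g] *)
  have [e0|e0] := eqVneq (inner e e) 0; last by rewrite mulNr divfK// subrr.
  rewrite e0 mulr0 addr0 inner_null// L2normE//.
  by move: e0; rewrite innerE => -[-> _]; rewrite sqrtr0.
exists (fun i => if (i < p)%N then a i - t * c i else t) => j.
rewrite (_ : (fun x => _) = (fun x => g x - t * e x)); last first.
  apply/funext => x; rewrite big_ord_recr/= ltnn.
  under eq_bigr do rewrite ltn_ord mulrBl -mulrA.
  by rewrite sumrB -mulr_sumr /g /e; ring.
have gteL : L2 (fun x => g x - t * e x) by apply: L2B => //; exact: L2Z.
have ortho i : (i < p)%N -> inner (fun x => g x - t * e x) (v i) = 0.
  move=> ip; rewrite (_ : (fun x => _) = (fun x => g x + (- t) * e x)).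
    by rewrite innerDl ?innerZl ?aP ?cP ?mulr0 ?addr0//; exact: L2Z.
  by apply/funext => x; rewrite mulNr.
rewrite ltnS leq_eqVlt => /predU1P[->|]; last exact: ortho.
have -> : v p = (fun x => e x + \sum_(i < p) c i * v i x).
  by apply/funext => x; rewrite /e subrK.
rewrite innerDr// te inner_sumr// big1 ?addr0// => i _.
by rewrite ortho ?mulr0.
Qed.

Lemma exists_orthogonal_projection (m : nat) (v : 'I_m -> F) :
  (forall i, L2 (v i)) ->
  exists2 P : F -> F, orthogonal_projection (L2span v) P &
    forall (f : F) (a : 'I_m -> R[i]), L2 f ->
      L2norm (fun x => f x - P f x) <=
      L2norm (fun x => f x - \sum_(i < m) a i * v i x).
Proof.
move=> vL.
pose v' (i : nat) : F := if insub i is Some j then v j else fun=> 0.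
have v'E (i : 'I_m) : v' i = v i by rewrite /v' valK.
have v'L i : L2 (v' i) by rewrite /v'; case: insub => *; [|exact: L2_0].
have sL (a : 'I_m -> R[i]) : L2 (fun x => \sum_(i < m) a i * v i x).
  by apply: L2_sum => i; exact: L2Z.
have /choice[c cP] (f : F) : exists a : 'I_m -> R[i], L2 f ->
    forall j, inner (fun x => f x - \sum_(i < m) a i * v i x) (v j) = 0.
  have [fL|nfL] := pselect (L2 f); last by exists (fun=> 0).
  have [a aP] := exists_projection m v'L fL.
  exists (fun i => a i) => _ j; have := aP j (ltn_ord j).
  by under eq_fun do under eq_bigr do rewrite v'E; rewrite v'E.
pose P f x := \sum_(i < m) c f i * v i x.
have PL f : L2 (P f) by exact: sL.
have ortho f (a : 'I_m -> R[i]) : L2 f ->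
    inner (fun x => f x - P f x) (fun x => \sum_(i < m) a i * v i x) = 0.
  move=> fL; rewrite inner_sumr//; last exact: L2B.
  by apply: big1 => i _; rewrite cP// mulr0.
exists P => [f fL|f a fL].
  split; first by split => //; exists (c f); apply: aeW.
  move=> w [wL [a wa]].
  have -> : w = (fun x => \sum_(i < m) a i * v i x +
                         (w x - \sum_(i < m) a i * v i x)).
    by apply/funext => x; rewrite addrC subrK.
  have fPL := L2B fL (PL f).
  have waL := L2B wL (sL a).
  rewrite innerDr// ortho// add0r inner_null// aeq0_L2norm//.
  by apply: filterS wa => x ->; rewrite subrr.
have fPL := L2B fL (PL f).
have PaL := L2B (PL f) (sL a).
rewrite -(@ler_pXn2r _ 2)// ?nnegrE ?L2norm_ge0//.
have -> : (fun x => f x - \sum_(i < m) a i * v i x) =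
  (fun x => (f x - P f x) + (P f x - \sum_(i < m) a i * v i x)).
  by apply/funext => x; rewrite addrA subrK.
set g := (fun x => f x - P f x) in fPL *.
set h := (fun x => P f x - _) in PaL *.
rewrite !sqr_L2norm//; last exact: L2D.
have : inner g h = 0.
  rewrite -[RHS](ortho f (fun i => c f i - a i) fL); congr inner.
  by apply/funext => x; rewrite /h /P -sumrB; apply: eq_bigr => i _; rewrite mulrBl.
rewrite innerE => -[fP0 _].
have ghL : L2 (fun x => g x + h x) by exact: L2D.
rewrite dotpDl// (dotpDr fPL PaL fPL) (dotpDr fPL PaL PaL).
rewrite (dotpC h g) fP0 addr0 add0r lerDl.
exact: dotp_ge0.
Qed.

End L2Space.

(** * The complex exponential *)

Section ComplexExponential.
Context {R : realType}.
Implicit Types (u w z : R[i]) (t K : R).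

Lemma Cabs_ge0 z : 0 <= Cabs z.
Proof. by case: z => ? ?; exact: sqrtr_ge0. Qed.

Lemma CabsM w z : Cabs (w * z) = Cabs w * Cabs z.
Proof. exact: ComplexField.Normc.normcM. Qed.

Lemma CabsD w z : Cabs (w + z) <= Cabs w + Cabs z.
Proof. exact: le_normcD. Qed.

Lemma CabsN z : Cabs (- z) = Cabs z.
Proof. exact: normcN. Qed.

Lemma CabsX z n : Cabs (z ^+ n) = Cabs z ^+ n.
Proof.
elim: n => [|n IH]; first by rewrite !expr0 ComplexField.Normc.normc1.
by rewrite !exprS CabsM IH.
Qed.

Lemma Cabs_real t : Cabs t%:C = `|t|.
Proof. by rewrite /= expr0n/= addr0 sqrtr_sqr. Qed.

Lemma Cabs_sum (I : Type) (r : seq I) (P : pred I) (f : I -> R[i]) :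
  Cabs (\sum_(i <- r | P i) f i) <= \sum_(i <- r | P i) Cabs (f i).
Proof.
elim/big_rec2: _ => [|i x y _ IH]; first by rewrite ComplexField.Normc.normc0.
by apply: le_trans (CabsD _ _) _; rewrite lerD2l.
Qed.

Lemma Re_le_Cabs z : Re z <= Cabs z.
Proof.
case: z => a b /=; apply: le_trans (ler_norm _) _.
by rewrite -sqrtr_sqr ler_wsqrtr// lerDl sqr_ge0.
Qed.

(** The modulus is a supremum of real parts of rotations, which reduces
complex estimates to estimates of real functions. *)
Lemma Cabs_rotation z : exists2 u, Cabs u = 1 & Re (u * z) = Cabs z.
Proof.
have [->|z0] := eqVneq z 0.
  exists 1; first exact: ComplexField.Normc.normc1.
  by rewrite mulr0 ComplexField.Normc.normc0.
have n0 : Cabs z != 0.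
  by apply: contra z0 => /eqP/ComplexField.Normc.eq0_normc ->.
case: z z0 n0 => a b _; set r := Cabs _ => r0.
have r2 : r ^+ 2 = a ^+ 2 + b ^+ 2.
  by rewrite /r /= sqr_sqrtr// addr_ge0 ?sqr_ge0.
exists ((a / r) +i* (- b / r)) => /=.
  rewrite !exprMn sqrrN -mulrDl -r2 -exprMn divff// expr1n sqrtr1 //.
by apply: (mulIf r0); rewrite mulrBl -expr2 r2; field.
Qed.

Lemma cexpD w z : cexp (w + z) = cexp w * cexp z.
Proof.
case: w z => [a b] [c d]; rewrite /cexp /= expRD sinD cosD.
by simpc; congr (_ +i* _); ring.
Qed.

Lemma cexp0 : cexp (0 : R[i]) = 1.
Proof. by rewrite /cexp /= expR0 cos0 sin0 mulr0 mulr1. Qed.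

Lemma cexpX w n : cexp w ^+ n = cexp (w *+ n).
Proof.
by elim: n => [|n IH]; rewrite ?mulr0n ?cexp0// exprS IH -cexpD mulrS.
Qed.

Lemma Cabs_cexp z : Cabs (cexp z) = expR (Re z).
Proof.
rewrite /cexp /= !exprMn -mulrDr cos2Dsin2 mulr1 sqrtr_sqr.
by rewrite ger0_norm ?expR_ge0.
Qed.

(** Remainders of the Taylor expansion of [t |-> Re (u exp (t w))]: the
derivative of one is the preceding one for the rotated coefficient [u w]. *)
Let rem m u w t : R :=
  Re (u * cexp (t%:C * w)) - \sum_(j < m) t ^+ j / j`!%:R * Re (u * w ^+ j).

Let rem_derive m u w t : is_derive t 1 (rem m.+1 u w) (rem m (u * w) w t).
Proof.
elim: m => [|m IH].
  rewrite /rem; case: u w => [p q] [a b].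
  rewrite (_ : (fun t : R => _) = (fun t : R => expR (a * t) *
     (p * cos (b * t) - q * sin (b * t)) - p)); last first.
    apply/funext => s; rewrite big_ord_recl big_ord0 /= !expr0 fact0.
    rewrite !mul0r !subr0 !addr0 /=; rewrite ?mulr1 ?mulr0 ?subr0 ?invr1 ?mulr1.
    by rewrite !(mulrC s); ring.
  apply: is_derive_eq; rewrite big_ord0 /= /GRing.scale /= ?mul0r ?subr0 ?addr0.
  by rewrite !(mulrC t); ring.
have dX := is_deriveX m.+1 (is_derive_id t (1 : R)).
pose c := Re (u * w ^+ m.+1) / m.+1`!%:R.
have -> : rem m.+2 u w = rem m.+1 u w - c \*: (id ^+ m.+1).
  apply/funext => s; rewrite /rem big_ord_recr/= opprD addrA !fctE.
  by congr (_ - _); rewrite -[RHS]/(c * _) /c; ring.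
apply: (is_derive_eq (is_deriveB IH (is_deriveZ c dX))).
rewrite -[LHS]/(_ - c * (m.+1%:R * t ^+ m * 1)).
rewrite [RHS]/rem big_ord_recr/= /rem opprD addrA; congr (_ - _).
rewrite -(mulrA u w) -exprS /c factS natrM; field.
by rewrite pnatr_eq0 -lt0n fact_gt0 nat1r pnatr_eq0.
Qed.

Let rem_le K m u w t : 1 <= K -> 0 <= t ->
  rem m u w t <= Cabs u * expR (K * Cabs w * t) / K ^+ m.
Proof.
move=> K1; have K0 : 0 < K by exact: lt_le_trans K1.
elim: m u t => [|m IH] u t t0.
  rewrite /rem big_ord0 subr0 expr0 divr1.
  apply: le_trans (Re_le_Cabs _) _; rewrite CabsM ler_wpM2l ?Cabs_ge0//.
  rewrite Cabs_cexp ler_expR; apply: le_trans (Re_le_Cabs _) _.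
  rewrite CabsM Cabs_real ger0_norm// mulrC ler_wpM2r//.
  by rewrite ler_peMl ?Cabs_ge0.
pose f (s : R) : R := Cabs u * expR (K * Cabs w * s) / K ^+ m.+1 - rem m.+1 u w s.
pose df (s : R) : R := Cabs (u * w) * expR (K * Cabs w * s) / K ^+ m - rem m (u * w) w s.
have fdf (s : R) : is_derive s 1 f (df s).
  have ? := rem_derive m u w s.
  rewrite /f; apply: is_derive_eq.
  rewrite /df CabsM /GRing.scale /= ?mulr0 ?mulr1 ?add0r ?addr0; congr (_ - _).
  by rewrite exprS; field; rewrite expf_neq0 gt_eqF.
have cf : continuous f.
  by move=> s; apply: differentiable_continuous; apply/derivable1_diffP; case: (fdf s).
have [c c0t ft] : exists2 c, c \in `[0, t] & f t - f 0 = df c * (t - 0).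
  by apply: MVT_segment => //; exact: continuous_subspaceT.
have f0 : 0 <= f 0.
  rewrite /f /rem big_ord_recl big1 => [|i _]; last first.
    by rewrite /= exprS !mul0r.
  rewrite !mul0r cexp0 mulr0 expR0 !expr0 fact0 divr1 mul1r addr0 mulr1 subrr.
  by rewrite subr0 mulr1 divr_ge0 ?Cabs_ge0 ?exprn_ge0 ?(ltW K0).
have : 0 <= f t.
  rewrite -(subrK (f 0) (f t)) ft addr_ge0// subr0 mulr_ge0//.
  by rewrite subr_ge0 IH//; move: c0t; rewrite in_itv/= => /andP[].
by rewrite subr_ge0.
Qed.

Lemma ReB w z : Re (w - z) = Re w - Re z.
Proof. by case: w z => [? ?] []. Qed.

Lemma Re_sum (I : Type) (r : seq I) (P : pred I) (f : I -> R[i]) :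
  Re (\sum_(i <- r | P i) f i) = \sum_(i <- r | P i) Re (f i).
Proof. exact: (raddf_sum (@Re R : Rcomplex R -> R)). Qed.

(** The free parameter [K] trades the power of [K] gained against the growth
of the exponential: [K = 2] yields geometric convergence, and [K = 1 / |w|]
the sharp order of vanishing at small [w]. *)
Lemma cexp_taylor K m w : 1 <= K ->
  Cabs (cexp w - \sum_(j < m) (j`!%:R^-1)%:C * w ^+ j) <=
  expR (K * Cabs w) / K ^+ m.
Proof.
move=> K1; have [u u1 <-] := Cabs_rotation (cexp w -
  \sum_(j < m) (j`!%:R^-1)%:C * w ^+ j).
have := @rem_le K m u w 1 K1 ler01.
rewrite u1 mul1r mulr1; apply: le_trans.
rewrite /rem mul1r le_eqVlt; apply/orP; left; apply/eqP.
rewrite mulrBr ReB mulr_sumr Re_sum; congr (_ - _).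
apply: eq_bigr => j _; rewrite expr1n mul1r mulrCA.
by case: (u * w ^+ j) => a b /=; rewrite mul0r subr0.
Qed.

Lemma cexp_sub1_le w : Cabs w <= 1 -> Cabs (cexp w - 1) <= expR 1 * Cabs w.
Proof.
have [->|w0] := eqVneq w 0.
  by rewrite cexp0 subrr ComplexField.Normc.normc0 mulr0.
have n0 : 0 < Cabs w.
  rewrite lt_def Cabs_ge0 andbT.
  by apply: contra w0 => /eqP/ComplexField.Normc.eq0_normc ->.
move=> w1; have := @cexp_taylor (Cabs w)^-1 1 w.
rewrite big_ord_recl big_ord0 expr0 fact0 invr1 mulr1 addr0.
by rewrite mulVf ?gt_eqF// expr1 invrK; apply; rewrite invf_ge1.
Qed.

Lemma cexp_sub1D_le w :
  Cabs w <= 1 -> Cabs (cexp w - 1 - w) <= expR 1 * Cabs w ^+ 2.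
Proof.
have [->|w0] := eqVneq w 0.
  by rewrite cexp0 !subrr ComplexField.Normc.normc0 expr0n mulr0.
have n0 : 0 < Cabs w.
  rewrite lt_def Cabs_ge0 andbT.
  by apply: contra w0 => /eqP/ComplexField.Normc.eq0_normc ->.
move=> w1; have := @cexp_taylor (Cabs w)^-1 2 w.
rewrite !big_ord_recl big_ord0 expr0 expr1 factS fact0 invr1 !mulr1 addr0 mul1r.
by rewrite mulVf ?gt_eqF// exprVn invrK opprD addrA; apply; rewrite invf_ge1.
Qed.

End ComplexExponential.

(** * Estimates uniform over the sector *)

Section ScalarEstimates.
Context {R : realType}.
Implicit Types (z l w : R[i]) (s t q p : R).

Lemma sector_Re (delta : R) z : 0 < delta < pi / 2%:R -> sector delta z ->
  cos delta * Cabs z <= Re z.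
Proof.
move=> /andP[d0 dpi] [r [a [r0 ad ->]]] /=.
rewrite !exprMn -mulrDr cos2Dsin2 mulr1 sqrtr_sqr ger0_norm// mulrC.
have pi2 : pi / 2%:R <= pi :> R.
  by rewrite ler_pdivrMr// ler_peMr ?ler1n// ltW// pi_gt0.
have aI : `|a| \in `[0, pi].
  by rewrite in_itv/= normr_ge0 (le_trans ad)// ltW// (lt_le_trans dpi).
have dI : delta \in `[0, pi].
  by rewrite in_itv/= (ltW d0) ltW// (lt_le_trans dpi).
by rewrite ler_wpM2l// -(cos_norm a) leNgt ltr_cos// -leNgt.
Qed.

Lemma cos_sector_gt0 (delta : R) : 0 < delta < pi / 2%:R -> 0 < cos delta.
Proof.
move=> /andP[d0 dpi]; apply: cos_gt0_pihalf; rewrite dpi andbT.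
by rewrite (lt_trans _ d0)// oppr_lt0 (lt_trans d0).
Qed.

Lemma cexp_time l t : cexp (- l * t%:C) = cexp (- (t%:C * l)).
Proof. by rewrite mulNr mulrC. Qed.

(** Taylor expansion at [s] on the window [[s, (1 + q) s]]: the factor
[exp (- s Re l)] absorbs the growth [exp (2 |l| (t - s))] of the remainder
bound, so that the error is geometric in the order, uniformly in [l] over the
sector. *)
Lemma cexp_window q l s t m : 0 < q -> 2 * q * Cabs l <= Re l ->
    0 < s -> s <= t <= (1 + q) * s ->
  Cabs (cexp (- l * t%:C) -
    \sum_(j < m) ((t - s) ^+ j)%:C *
      ((j`!%:R^-1)%:C * (- l) ^+ j * cexp (- l * s%:C))) <= (2 ^+ m)^-1.
Proof.
move=> q0 ql s0 /andP[st tqs].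
have -> : cexp (- l * t%:C) = cexp (- l * s%:C) * cexp (- l * (t - s)%:C).
  by rewrite -cexpD -mulrDr -rmorphD/= addrC subrK.
have -> : \sum_(j < m) ((t - s) ^+ j)%:C *
      ((j`!%:R^-1)%:C * (- l) ^+ j * cexp (- l * s%:C)) =
   cexp (- l * s%:C) *
     \sum_(j < m) (j`!%:R^-1)%:C * (- l * (t - s)%:C) ^+ j.
  rewrite mulr_sumr; apply: eq_bigr => j _.
  by rewrite exprMn -rmorphXn/=; ring.
rewrite -mulrBr CabsM.
have := @cexp_taylor _ 2 m (- l * (t - s)%:C) _.
rewrite ler1n => /(_ isT) => tay.
apply: le_trans (ler_wpM2l (Cabs_ge0 _) tay) _.
rewrite Cabs_cexp mulrA -expRD ler_piMl ?invr_ge0 ?exprn_ge0//.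
rewrite -[leRHS]expR0 ler_expR CabsM CabsN Cabs_real ger0_norm ?subr_ge0//.
have -> : Re (- l * s%:C) = - (Re l * s).
  by case: (l) => a b /=; rewrite mulr0 subr0 mulNr.
rewrite addrC subr_le0.
apply: le_trans (_ : 2 * (Cabs l * (q * s)) <= _).
  by rewrite ler_wpM2l// ler_wpM2l ?Cabs_ge0//; lra.
apply: le_trans (ler_wpM2r (ltW s0) ql).
by rewrite le_eqVlt; apply/orP; left; apply/eqP; ring.
Qed.

Lemma Cabs_cexp_le1 l t : 0 <= Re l -> 0 <= t -> Cabs (cexp (- l * t%:C)) <= 1.
Proof.
move=> l0 t0; rewrite Cabs_cexp -[leRHS]expR0 ler_expR.
by case: l l0 => a b /= a0; rewrite mulr0 subr0 mulNr oppr_le0 mulr_ge0.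
Qed.

Lemma expR1_ge2 : 2 <= expR 1 :> R.
Proof. by have := @expR_ge1Dx R 1; lra. Qed.

(** The fractional exponent makes the bound summable against the coefficients
when [|l|] is an eigenvalue growing like a power of its rank. *)
Lemma cexp_initial_layer (sg : R) l t : 0 < sg <= 1 -> 0 <= Re l -> 0 <= t ->
  Cabs (1 - cexp (- l * t%:C)) <= expR 1 * (Cabs l * t) `^ sg.
Proof.
move=> /andP[sg0 sg1] l0 t0.
rewrite -CabsN opprB.
have wE : Cabs (- l * t%:C) = Cabs l * t.
  by rewrite CabsM CabsN Cabs_real ger0_norm.
have [w1|w1] := leP (Cabs l * t) 1.
  apply: le_trans (cexp_sub1_le _) _; rewrite wE//.
  rewrite ler_wpM2l ?expR_ge0//.
  have := mulr_ge0 (Cabs_ge0 l) t0; rewrite le_eqVlt => /predU1P[<-|w0].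
    exact: powR_ge0.
  by apply: ger1_powR => //; rewrite w0.
apply: le_trans (CabsD _ _) _.
rewrite CabsN ComplexField.Normc.normc1.
have := Cabs_cexp_le1 l0 t0.
have : 1 <= (Cabs l * t) `^ sg.
  by rewrite -(powRr0 (Cabs l * t)) ler_powR// ltW.
have := expR1_ge2; nra.
Qed.

(** The local error of the implicit Euler scheme is quadratic. *)
Lemma cexp_implicit_euler w : 0 <= Re w -> Cabs w <= 1 ->
  Cabs (cexp (- w) - (1 + w)^-1) <= (2 * expR 1 + 1) * Cabs w ^+ 2.
Proof.
move=> w0 w1.
have w1_ge1 : 1 <= Cabs (1 + w).
  apply: le_trans (Re_le_Cabs _).
  by case: w w0 {w1} => a b /= a0; rewrite lerDl.
have w1_neq0 : 1 + w != 0.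
  by apply/eqP => w10; move: w1_ge1; rewrite w10 ComplexField.Normc.normc0 ler10.
have -> : cexp (- w) - (1 + w)^-1 =
    ((cexp (- w) - 1 - - w) * (1 + w) - w ^+ 2) / (1 + w) by field.
rewrite CabsM ComplexField.Normc.normcV.
apply: le_trans (_ : Cabs ((cexp (- w) - 1 - - w) * (1 + w) - w ^+ 2) <= _).
  by rewrite ler_piMr ?Cabs_ge0// invf_le1// (lt_le_trans ltr01).
apply: le_trans (CabsD _ _) _; rewrite CabsN CabsX [leRHS]mulrDl mul1r lerD2r CabsM.
have := @cexp_sub1D_le _ (- w); rewrite CabsN => /(_ w1) h.
have w2 : Cabs (1 + w) <= 2.
  apply: le_trans (CabsD _ _) _; rewrite ComplexField.Normc.normc1.
  by rewrite -[leRHS]/(1 + 1) lerD2l.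
have := ler_pM (Cabs_ge0 _) (Cabs_ge0 _) h w2.
by rewrite mulrC -mulrA mulrC mulrAC (mulrC _ 2) mulrA => /le_trans; apply.
Qed.

Lemma Cabs_subXX_le w z n : Cabs w <= 1 -> Cabs z <= 1 ->
  Cabs (w ^+ n - z ^+ n) <= n%:R * Cabs (w - z).
Proof.
move=> w1 z1; rewrite subrXX CabsM mulrC ler_wpM2r ?Cabs_ge0//.
apply: le_trans (Cabs_sum _ _ _) _.
rewrite -[leRHS]mulr_natl mulr1 -[X in _ <= X%:R]card_ord -sumr_const.
apply: ler_sum => i _; rewrite CabsM !CabsX.
by rewrite mulr_ile1 ?exprn_ge0 ?Cabs_ge0// exprn_ile1 ?Cabs_ge0.
Qed.

(** The Post-Widder limit, with a rate: [n] steps of size [1 / n] accumulate [n]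
local errors of size [|w|^2 / n^2]. *)
Lemma cexp_post_widder w n : (0 < n)%N -> 0 <= Re w -> Cabs w <= n%:R ->
  Cabs (cexp (- w) - ((1 + n%:R^-1%:C * w)^-1) ^+ n) <=
  (2 * expR 1 + 1) * Cabs w ^+ 2 / n%:R.
Proof.
move=> n0 w0 wn; have n0R : 0 < n%:R :> R by rewrite ltr0n.
set v := n%:R^-1%:C * w.
have vE : Cabs v = Cabs w / n%:R.
  by rewrite CabsM Cabs_real ger0_norm ?invr_ge0// mulrC.
have v1 : Cabs v <= 1 by rewrite vE ler_pdivrMr// mul1r.
have v0 : 0 <= Re v.
  by rewrite /v; case: w w0 {wn v vE v1} => a b /= a0; rewrite mul0r subr0 mulr_ge0.
have -> : cexp (- w) = cexp (- v) ^+ n.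
  rewrite cexpX mulNrn -mulrnAl; congr (cexp (- _)).
  rewrite -rmorphMn/= -mulr_natl mulfV ?gt_eqF//.
  by rewrite [1%:C]/(1 : R[i]) mul1r.
apply: le_trans (Cabs_subXX_le _ _ _) _.
- rewrite Cabs_cexp -[leRHS]expR0 ler_expR.
  by case: v v0 {vE v1} => a b /= ?; rewrite oppr_le0.
- rewrite ComplexField.Normc.normcV invf_le1.
    by apply: le_trans (Re_le_Cabs _); case: v v0 {vE v1} => a b /= ?; rewrite lerDl.
  apply: lt_le_trans (Re_le_Cabs _); case: v v0 {vE v1} => a b /= ?.
  by rewrite ltr_pwDl.
have := cexp_implicit_euler v0 v1; rewrite vE => h.
apply: le_trans (ler_wpM2l (ltW n0R) h) _.
rewrite le_eqVlt; apply/orP; left; apply/eqP; field; exact: lt0r_neq0.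
Qed.

(** * Tails of p-series *)

(** The discrete form of the comparison of [x^(- q - 1)] with the derivative of
[x^(- q)], from [exp y >= 1 + y] and [ln (1 + y) <= y]. *)
Lemma powR_diff_ge q (k : nat) : 0 < q -> (0 < k)%N ->
  q * k.+1%:R `^ (- (q + 1)) <= k%:R `^ (- q) - k.+1%:R `^ (- q) :> R.
Proof.
move=> q0 k0; have k0R : 0 < k%:R :> R by rewrite ltr0n.
have k1R : 0 < k.+1%:R :> R by rewrite ltr0n.
rewrite opprD powRD; last by rewrite (gt_eqF k1R) implybT.
rewrite (powR_inv1 (ltW k1R)) lerBrDr.
have -> : k%:R `^ (- q) = k.+1%:R `^ (- q) * expR (q * (ln k.+1%:R - ln k%:R)).
  rewrite /powR !gt_eqF// -expRD; congr expR; ring.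
rewrite mulrCA -[X in _ + X]mulr1 -mulrDr ler_wpM2l ?powR_ge0//.
apply: le_trans (expR_ge1Dx _); rewrite addrC lerD2l ler_wpM2l ?(ltW q0)//.
have : ln (1 + - k.+1%:R^-1) <= - k.+1%:R^-1 :> R.
  by apply: le_ln1Dx; rewrite ltrN2 invf_lt1// ltr1n ltnS.
rewrite (_ : 1 + - k.+1%:R^-1 = k%:R / k.+1%:R); last first.
  by rewrite -natr1; field; rewrite natr1 gt_eqF.
by rewrite ln_div ?posrE// => h; rewrite -lerN2 opprB.
Qed.

Lemma pseries_tail q (N M : nat) : 0 < q -> (0 < N)%N ->
  \sum_(N <= k < M) k.+1%:R `^ (- (q + 1)) <= q^-1 * N%:R `^ (- q) :> R.
Proof.
move=> q0 N0; have [MN|NM] := leqP M N.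
  by rewrite big_geq// mulr_ge0 ?invr_ge0 ?powR_ge0 ?ltW.
suff : q * \sum_(N <= k < M) k.+1%:R `^ (- (q + 1)) <=
    N%:R `^ (- q) - M%:R `^ (- q) :> R.
  rewrite -ler_pdivlMl// => /le_trans; apply.
  by rewrite ler_wpM2l ?invr_ge0 ?(ltW q0)// gerBl powR_ge0.
rewrite mulr_sumr -[leRHS]opprB -(telescope_sumr (fun k => k%:R `^ (- q)) (ltnW NM)) -sumrN.
rewrite !big_nat; apply: ler_sum => k /andP[Nk _].
by rewrite opprB powR_diff_ge// (leq_trans N0).
Qed.

Lemma pseries_le q (M : nat) : 0 < q ->
  \sum_(k < M) k.+1%:R `^ (- (q + 1)) <= 1 + q^-1 :> R.
Proof.
move=> q0; case: M => [|M].
  by rewrite big_ord0 addr_ge0 ?invr_ge0 ?ltW.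
rewrite -(big_mkord xpredT (fun k => k.+1%:R `^ (- (q + 1)))) big_ltn// powR1.
rewrite lerD2l; apply: le_trans (pseries_tail _ q0 (ltn0Sn 0)) _.
by rewrite powR1 mulr1.
Qed.

End ScalarEstimates.

(** * Expansions in eigenfunctions *)

(** Logarithmically many geometric steps reach any power [expR (a * L)]. *)
Lemma exists_exprn_ge {R : realType} (rho a L : R) : 1 < rho -> 0 < a -> 1 <= L ->
  exists2 n : nat, n%:R <= (a / ln rho + 1) * L & expR (a * L) <= rho ^+ n.
Proof.
move=> rho1 a0 L1.
have rho0 : 0 < rho by exact: lt_trans rho1.
have lrho : 0 < ln rho by exact: ln_gt0.
set y := a * L / ln rho.
have y0 : 0 <= y by rewrite !mulr_ge0 ?invr_ge0 ?(ltW lrho) ?(ltW a0) ?(le_trans ler01).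
exists (Num.truncn y).+1.
  have := truncn_le y; rewrite y0 => yn.
  rewrite -natr1 mulrDl mul1r lerD//; apply: le_trans yn _.
  by rewrite /y mulrAC.
rewrite -[X in _ <= X ^+ _](@lnK _ rho) ?posrE// -expRM_natl ler_expR.
by rewrite -ler_pdivrMr// ltW// truncnS_gt.
Qed.

Lemma geometric_window {R : realType} (rho s t : R) (n : nat) :
  s < t <= s * rho ^+ n ->
  exists2 i : 'I_n, s * rho ^+ i <= t & t <= rho * (s * rho ^+ i).
Proof.
elim: n => [|n IH].
  by rewrite expr0 mulr1 => /andP[+ ts]; rewrite ltNge ts.
move=> /andP[st tn]; have [tn'|nt] := leP t (s * rho ^+ n).
  have [|i i1 i2] := IH; first by rewrite st.
  by exists (widen_ord (leqnSn n) i).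
by exists ord_max; [exact: ltW | rewrite mulrCA -exprS].
Qed.

Section Expansions.
Context {R : realType} {d : nat}.
Local Notation F := (tfun R d).

Lemma L2cvg_dist_le (fN : nat -> F) (f g : F) (N : nat) (E : R) :
    (forall M, L2 (fN M)) -> L2 f -> L2 g -> L2cvg fN f ->
    (forall M, (N <= M)%N -> L2norm (fun x => fN M x - g x) <= E) ->
  L2norm (fun x => f x - g x) <= E.
Proof.
move=> fNL fL gL fNf fNg; apply/ler_addgt0Pr => e e0.
have /cvgrPdist_lt/(_ e e0)[K _ KP] := fNf.
have := KP (maxn K N) (leq_maxl _ _); rewrite sub0r normrN ger0_norm => [h|].
  apply: le_trans (L2normB_triangle fL (fNL (maxn K N)) gL) _.
  rewrite addrC lerD ?fNg ?leq_maxr// ltW//.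
  rewrite -L2normN; last exact: L2B.
  by under eq_fun do rewrite opprB.
exact: L2norm_ge0.
Qed.

Variables (phi : nat -> F) (lam c : nat -> R[i]).
Hypothesis phiL : forall k, L2 (phi k).
Hypothesis phi1 : forall k, L2norm (phi k) = 1.
Hypothesis lam0 : forall k, 0 <= Re (lam k).

Let phi_le1 k : L2norm (phi k) <= 1. Proof. by rewrite phi1. Qed.

(** Replacing the first [N] exponential factors by arbitrary numbers [b k] and
dropping the others costs the two sums of moduli, by the triangle inequality:
the eigenfunctions are normalised, but in general not orthogonal. *)
Lemma expansion_error (v : F) (N : nat) (b : nat -> R[i]) (m t E1 E2 : R) :
    L2 v -> 0 <= t ->
    L2cvg (fun M x => (expR (m * t))%:C *
             \sum_(k < M) c k * cexp (- lam k * t%:C) * phi k x) v ->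
    \sum_(k < N) Cabs (c k) * Cabs (cexp (- lam k * t%:C) - b k) <= E1 ->
    (forall M, \sum_(N <= k < M) Cabs (c k) <= E2) ->
  L2norm (fun x => v x - (expR (m * t))%:C * \sum_(k < N) c k * b k * phi k x)
  <= expR (m * t) * (E1 + E2).
Proof.
move=> vL t0 vcvg hE1 hE2.
have sumL (a : nat -> R[i]) M : L2 (fun x => \sum_(k < M) a k * phi k x).
  by apply: L2_sum => k; exact: L2Z.
apply: (@L2cvg_dist_le _ _ _ N _ _ _ _ vcvg) => //.
- by move=> M; apply: L2Z; exact: (sumL (fun k => c k * cexp (- lam k * t%:C))).
- by apply: L2Z; exact: (sumL (fun k => c k * b k)).
move=> M NM.
pose b' k := if (k < N)%N then b k else 0.
rewrite (_ : (fun x => _) = (fun x => (expR (m * t))%:C *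
  \sum_(k < M) (c k * (cexp (- lam k * t%:C) - b' k)) * phi k x)); last first.
  apply/funext => x; rewrite -mulrBr; congr (_ * _).
  rewrite (big_ord_widen _ (fun k => c k * b k * phi k x) NM) [X in _ - X]big_mkcond/=.
  rewrite -sumrB; apply: eq_bigr => k _; rewrite /b'.
  by case: ifPn => _; ring.
rewrite L2normZ; last first.
  exact: (sumL (fun k => c k * (cexp (- lam k * t%:C) - b' k))).
rewrite Cabs_real ger0_norm ?expR_ge0// ler_wpM2l ?expR_ge0//.
apply: le_trans (L2norm_sum _ _ _ _ _) _ => //.
rewrite -(big_mkord xpredT (fun k => Cabs (c k * (cexp (- lam k * t%:C) - b' k)))).
rewrite (big_cat_nat (leq0n N) NM)/= lerD//.
  rewrite big_mkord; apply: le_trans hE1; apply: ler_sum => k _.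
  by rewrite CabsM /b' ltn_ord.
apply: le_trans (hE2 M); rewrite !big_nat; apply: ler_sum => k /andP[Nk _].
have -> : b' k = 0 by rewrite /b' ltnNge Nk.
rewrite CabsM subr0 ler_piMr ?Cabs_ge0//.
exact: (Cabs_cexp_le1 (lam0 k) t0).
Qed.

Variables (th gam : R).
Hypothesis th0 : 0 < th.
Hypothesis gam1 : 1 < gam.
Hypothesis c_le : forall k, Cabs (c k) <= th * k.+1%:R `^ (- gam).

Let gam0 : 0 < gam - 1. Proof. by rewrite subr_gt0. Qed.

Lemma tail_Cabs_coef_le (N M : nat) : (0 < N)%N ->
  \sum_(N <= k < M) Cabs (c k) <= th / (gam - 1) * N%:R `^ (- (gam - 1)).
Proof.
move=> N0; rewrite -mulrA; apply: le_trans (_ : th *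
  \sum_(N <= k < M) k.+1%:R `^ (- (gam - 1 + 1)) <= _).
  by rewrite mulr_sumr; apply: ler_sum => k _; rewrite subrK.
by rewrite ler_wpM2l ?(ltW th0)//; exact: pseries_tail.
Qed.

Lemma sum_Cabs_coef_le (N : nat) :
  \sum_(k < N) Cabs (c k) <= th * (1 + (gam - 1)^-1).
Proof.
apply: le_trans (_ : th * \sum_(k < N) k.+1%:R `^ (- (gam - 1 + 1)) <= _).
  by rewrite mulr_sumr; apply: ler_sum => k _; rewrite subrK.
by rewrite ler_wpM2l ?(ltW th0)//; exact: pseries_le.
Qed.

Lemma exists_powRN_le (p e : R) : 0 < p -> 0 < e ->
  exists2 N : nat, (0 < N)%N & N%:R `^ (- p) <= e.
Proof.
move=> p0 e0; exists (Num.truncn (e `^ (- p^-1))).+1 => //.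
set N := _.+1; have eN : e `^ (- p^-1) < N%:R by exact: truncnS_gt.
rewrite powRN -[leRHS]invrK lef_pV2 ?posrE ?powR_gt0 ?invr_gt0 ?ltr0n//.
have -> : e^-1 = (e `^ (- p^-1)) `^ p.
  by rewrite -powRrM mulNr mulVf ?gt_eqF// powR_inv1 ?ltW.
by apply: ge0_ler_powR; rewrite ?(ltW p0)// ?nnegrE ?powR_ge0// ltW.
Qed.

Variables (be B : R).
Hypothesis be0 : 0 < be.
Hypothesis B0 : 0 < B.
Hypothesis lam_le : forall k, Cabs (lam k) <= B * k.+1%:R `^ be.
Local Notation kap := (be / (gam - 1)).
(** The Hoelder exponent in time of the solution at [t = 0]; it is chosen so
that [be * sg < gam - 1], which makes the weighted coefficients summable. *)
Local Notation sg := ((1 + 2 * kap)^-1).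

Let kap0 : 0 < kap. Proof. by rewrite divr_gt0. Qed.

Let sg_lt : 0 < gam - 1 - be * sg.
Proof.
have -> : gam - 1 - be * sg = (gam - 1) * ((gam - 1) + be) / ((gam - 1) + 2 * be).
  by field; apply/andP; split; apply/eqP; have := gam0; have := be0; lra.
have g0 := gam0; apply: divr_gt0; last by have := be0; lra.
by apply: mulr_gt0 => //; have := be0; lra.
Qed.

Lemma initial_layer_sum (N : nat) (t0 t : R) : 0 <= t <= t0 ->
  \sum_(k < N) Cabs (c k) * Cabs (cexp (- lam k * t%:C) - 1) <=
  th * expR 1 * B `^ sg * (1 + (gam - 1 - be * sg)^-1) * t0 `^ sg.
Proof.
move=> /andP[t_ge0 tt0]; have t00 : 0 <= t0 by exact: le_trans tt0.
have k1 : 1 <= 1 + 2 * kap by rewrite lerDl mulr_ge0// ltW.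
have k0 : 0 < 1 + 2 * kap by exact: lt_le_trans k1.
have sg0 : 0 < sg by rewrite invr_gt0.
have sg1 : sg <= 1 by rewrite invf_le1.
apply: le_trans (_ : th * expR 1 * B `^ sg * t0 `^ sg *
  \sum_(k < N) k.+1%:R `^ (- ((gam - 1 - be * sg) + 1)) <= _); last first.
  rewrite [leRHS]mulrAC ler_wpM2l ?pseries_le//.
  by rewrite !mulr_ge0 ?powR_ge0 ?expR_ge0 ?(ltW th0).
rewrite mulr_sumr; apply: ler_sum => k _.
have kR : 0 < k.+1%:R :> R by rewrite ltr0n.
have -> : - (gam - 1 - be * sg + 1) = - gam + be * sg by ring.
rewrite powRD; last by rewrite (gt_eqF kR) implybT.
rewrite powRrM.
apply: le_trans (ler_pM (Cabs_ge0 _) (Cabs_ge0 _) (c_le k)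
  (_ : _ <= expR 1 * (B * k.+1%:R `^ be * t0) `^ sg)) _.
  rewrite -CabsN opprB; apply: le_trans (cexp_initial_layer (sg := sg) _ _ _) _ => //.
    by rewrite sg0.
  rewrite ler_wpM2l ?expR_ge0// ge0_ler_powR ?(ltW sg0)//.
  - by rewrite nnegrE mulr_ge0 ?Cabs_ge0.
  - by rewrite nnegrE !mulr_ge0 ?powR_ge0 ?(ltW B0).
  - by rewrite ler_pM ?Cabs_ge0.
rewrite !powRM ?mulr_ge0 ?powR_ge0 ?(ltW B0)//.
rewrite le_eqVlt; apply/orP; left; apply/eqP; ring.
Qed.

Variables (q m T : R) (u : R -> F).
Hypothesis q0 : 0 < q.
Hypothesis m0 : 0 <= m.
Hypothesis lam_sector : forall k, 2 * q * Cabs (lam k) <= Re (lam k).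
Hypothesis uL : forall t, 0 <= t <= T -> L2 (u t).
Hypothesis u_cvg : forall t, 0 <= t <= T ->
  L2cvg (fun N x => (expR (m * t))%:C *
           \sum_(k < N) c k * cexp (- lam k * t%:C) * phi k x) (u t).

Local Notation window_const := ((3 + 4 * kap) / ln (1 + q) + 1).
Local Notation order_const := (2 / ln 2 + 1).

(** With [e^{-L}] the target accuracy, [q] the relative length of the windows
and [t0 = e^{-2 (1 + 2 kap) L}], the space is spanned by the truncated initial
value, which serves on [[0, t0]], and by the Taylor coefficients of the
truncated solution at the points [t0 (1 + q)^i], of which O(L) are needed to
reach [T], each up to an order O(L). The accuracy obtained is the square
[e^{-2 L}], which leaves room for constants. *)
Lemma low_rank_approximation (L : R) : 1 <= L -> T <= expR L ->
  exists (X : finType) (v : X -> F),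
  [/\ #|X|%:R <= (window_const * order_const + 1) * L ^+ 2,
      forall i, L2 (v i) &
      forall t, 0 <= t <= T -> exists a : X -> R[i],
        L2norm (fun x => u t x - \sum_i a i * v i x) <=
        expR (m * T) * (th * expR 1 * B `^ sg * (1 + (gam - 1 - be * sg)^-1)
          + th * (1 + (gam - 1)^-1) + th / (gam - 1)) * expR (- (2 * L))].
Proof.
move=> L1 TL.
have k0 : 0 < 1 + 2 * kap by rewrite addr_gt0// mulr_gt0.
have [I I_le I_ge] : exists2 n : nat, n%:R <= window_const * L &
    expR ((3 + 4 * kap) * L) <= (1 + q) ^+ n.
  by apply: exists_exprn_ge; rewrite ?ltrDl//; have := kap0; lra.
have [J J_le J_ge] : exists2 n : nat, n%:R <= order_const * L &
    expR (2 * L) <= 2 ^+ n.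
  by apply: exists_exprn_ge => //; rewrite ltr1n.
have [N N0 N_le] := exists_powRN_le gam0 (expR_gt0 (- (2 * L))).
set eta := expR (- (2 * L)) in N_le *.
have eta0 : 0 < eta by exact: expR_gt0.
pose t0 := expR (- (2 * (1 + 2 * kap) * L)).
have t00 : 0 < t0 by exact: expR_gt0.
have t0sg : t0 `^ sg = eta.
  by rewrite -expRM; congr expR; rewrite mulNr (mulrAC 2) mulfK ?gt_eqF.
pose s (i : 'I_I) := t0 * (1 + q) ^+ i.
have s0 i : 0 < s i by rewrite mulr_gt0// exprn_gt0// addr_gt0.
pose h (i : 'I_I) (j : 'I_J) k : R[i] :=
  (j`!%:R^-1)%:C * (- lam k) ^+ j * cexp (- lam k * (s i)%:C).
pose v (X : 'I_1 + 'I_I * 'I_J) : F :=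
  match X with
  | inl _ => fun x => \sum_(k < N) c k * 1 * phi k x
  | inr ij => fun x => \sum_(k < N) c k * h ij.1 ij.2 k * phi k x
  end.
exists ('I_1 + 'I_I * 'I_J)%type, v; split.
- rewrite card_sum card_prod !card_ord natrD natrM addrC mulrDl mul1r.
  rewrite lerD ?exprn_ege1// expr2 mulrACA ler_pM//.
- by case=> [i|[i j]]; apply: L2_sum => k; exact: L2Z.
move=> t tT; have /andP[t_ge0 t_leT] := tT.
set Cst := (X in expR (m * T) * X).
have tail M : \sum_(N <= k < M) Cabs (c k) <= th / (gam - 1) * eta.
  apply: le_trans (tail_Cabs_coef_le _ N0) _.
  by rewrite ler_wpM2l// mulr_ge0 ?invr_ge0 ?(ltW th0) ?(ltW gam0).
have mT E : 0 <= E -> E <= Cst * eta -> expR (m * t) * E <= expR (m * T) * Cst * eta.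
  move=> E0 ECst; rewrite -mulrA ler_pM ?expR_ge0//.
  by rewrite ler_expR ler_wpM2l.
have P1 : 0 <= th * expR 1 * B `^ sg * (1 + (gam - 1 - be * sg)^-1).
  rewrite !mulr_ge0 ?expR_ge0 ?powR_ge0 ?(ltW th0)//.
  by rewrite addr_ge0// invr_ge0 ltW.
have P2 : 0 <= th * (1 + (gam - 1)^-1).
  by rewrite mulr_ge0 ?(ltW th0)// addr_ge0// invr_ge0 ltW.
have P3 : 0 <= th / (gam - 1) by rewrite divr_ge0 ?(ltW th0) ?(ltW gam0).
have [tt0|t0t] := leP t t0.
  exists (fun X => if X is inl _ then (expR (m * t))%:C else 0).
  rewrite (_ : (fun x => _) = (fun x => u t x - (expR (m * t))%:C *
      \sum_(k < N) c k * 1 * phi k x)); last first.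
    apply/funext => x; congr (_ - _).
    rewrite big_sumType/= big_ord1 [X in _ + X]big1 ?addr0//.
    by move=> *; rewrite mul0r.
  have layer := initial_layer_sum N (t := t) (t0 := t0).
  rewrite t_ge0 tt0 t0sg in layer.
  apply: le_trans (expansion_error (b := fun=> 1) (uL tT) t_ge0
    (u_cvg tT) (layer isT) tail) _.
  apply: mT; first by rewrite addr_ge0// mulr_ge0// ltW.
  by rewrite -mulrDl ler_wpM2r ?(ltW eta0)// /Cst lerD2r lerDl.
have [|i si ti] := @geometric_window _ (1 + q) t0 t I.
  rewrite t0t/=; apply: le_trans t_leT _; apply: le_trans TL _.
  apply: le_trans (ler_wpM2l (ltW t00) I_ge).
  by rewrite -expRD ler_expR; lra.
exists (fun X : 'I_1 + 'I_I * 'I_J => if X is inr ij then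
  if ij.1 == i then (expR (m * t) * (t - s i) ^+ ij.2)%:C else 0 else 0).
pose b k := \sum_(j < J) ((t - s i) ^+ j)%:C * h i j k.
rewrite (_ : (fun x => _) = (fun x => u t x - (expR (m * t))%:C *
    \sum_(k < N) c k * b k * phi k x)); last first.
  apply/funext => x; congr (_ - _).
  rewrite big_sumType/= big_ord1 mul0r add0r.
  rewrite -(pair_bigA _ (fun (i' : 'I_I) (j : 'I_J) => (if i' == i then
    (expR (m * t) * (t - s i) ^+ j)%:C else 0) *
    \sum_(k < N) c k * h i' j k * phi k x))/=.
  rewrite (bigD1 i)//= [X in _ + X]big1 ?addr0 => [|i' /negbTE ii']; last first.
    by apply: big1 => j _; rewrite ii' mul0r.
  rewrite eqxx mulr_sumr; under eq_bigr do rewrite mulr_sumr.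
  rewrite exchange_big/=; apply: eq_bigr => k _.
  rewrite /b mulr_sumr mulr_suml mulr_sumr; apply: eq_bigr => j _.
  by rewrite rmorphM/=; ring.
have window : \sum_(k < N) Cabs (c k) * Cabs (cexp (- lam k * t%:C) - b k) <=
    th * (1 + (gam - 1)^-1) * eta.
  apply: le_trans (_ : \sum_(k < N) Cabs (c k) * eta <= _); last first.
    by rewrite -mulr_suml ler_wpM2r ?(ltW eta0)// sum_Cabs_coef_le.
  apply: ler_sum => k _; rewrite ler_wpM2l ?Cabs_ge0//.
  apply: le_trans (cexp_window J q0 (lam_sector k) (s0 i) _) _.
    by rewrite si ti.
  by rewrite /eta expRN lef_pV2// posrE ?expR_gt0 ?exprn_gt0.
apply: le_trans (expansion_error (b := b) (uL tT) t_ge0 (u_cvg tT)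
  window tail) _.
apply: mT; first by rewrite addr_ge0// mulr_ge0// ltW.
by rewrite -mulrDl ler_wpM2r ?(ltW eta0)// /Cst -addrA lerDr.
Qed.

End Expansions.

(** * Resolvents and eigenfunctions *)

Section Operators.
Context {R : realType} {d : nat}.
Local Notation F := (tfun R d).
Variables (A : F -> F -> Prop).

Lemma approximation_property_le (T kap C C' : R) : 0 < C -> C <= C' ->
  approximation_property A T kap C -> approximation_property A T kap C'.
Proof.
move=> C0 CC' AC S /AC [eps0 eps00 h]; exists eps0 => // eps /h{h}/=.
set N := `|Num.ceil (C * _)|%N; set N' := `|Num.ceil (C' * _)|%N.
move=> [b [z [zA zP]]].
have NN' : (N <= N')%N.
  have CL0 x : 0 <= x -> 0 <= Num.ceil (x * `|ln eps| ^+ 2).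
    by move=> x0; rewrite -[0](@ceil0 R) ceil_le// mulr_ge0 ?sqr_ge0.
  rewrite -lez_nat !gez0_abs ?CL0 ?(le_trans (ltW C0))// ?(ltW C0)//.
  by rewrite ceil_le// ler_wpM2r ?sqr_ge0.
(* padding: the additional terms have coefficient 0 and repeat the node [z 0] *)
pose b' (k : int) := if (`|k| <= N)%N then b k else 0.
pose z' (k : int) := if (`|k| <= N)%N then z k else z 0.
exists b', z'; split=> [k _|t f w tT fL wP].
  by rewrite /z'; case: ifPn => kN; apply: zA.
have {}zP := zP t f w tT fL; rewrite (_ : (fun x => _) = (fun x => S t f x -
    \sum_(j < (N.*2).+1) (let k := (j%:Z - N%:Z)%R in
       b k * cexp (- z k * t%:C) * w k x))).
  apply: zP => k kN; have := wP k (leq_trans kN NN').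
  by rewrite /z' kN.
apply/funext => x; congr (_ - _) => /=.
pose G k := b k * cexp (- z k * t%:C) * w k x.
pose G' k := b' k * cexp (- z' k * t%:C) * w k x.
have G'E k : (`|k| <= N)%N -> G' k = G k by rewrite /G' /b' /z' => ->.
have G'0 k : ~~ (`|k| <= N)%N -> G' k = 0.
  by rewrite /G' /b' => /negbTE ->; rewrite !mul0r.
rewrite -(big_mkord xpredT (fun j => G' (j%:Z - N'%:Z))).
rewrite -(big_mkord xpredT (fun j => G (j%:Z - N%:Z))).
have le1 : (N' - N <= (N' - N + (N.*2).+1)%N)%N by rewrite leq_addr.
have le2 : (N' - N + (N.*2).+1 <= (N'.*2).+1)%N by lia.
rewrite (big_cat_nat (leq0n (N' - N)) (leq_trans le1 le2))/=.
rewrite (big_cat_nat le1 le2)/=.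
rewrite big_nat big1 => [|j /andP[_ jN]]; last by apply: G'0; lia.
rewrite add0r [X in _ + X]big_nat [X in _ + X]big1 => [|j /andP[jN _]]; last first.
  by apply: G'0; lia.
rewrite addr0 -{1}[(N' - N)%N]add0n big_addn addKn.
apply: eq_big_nat => j jN.
rewrite (_ : (j + (N' - N))%:Z - N'%:Z = j%:Z - N%:Z)%R; last by lia.
by apply: G'E; lia.
Qed.

Let operator_eq1 f g f' g' : f =1 f' -> g =1 g' -> A f g -> A f' g'.
Proof. by move=> /funext -> /funext ->. Qed.

Hypothesis A_lin : linear_operator A.

Lemma operator_L2 f g : A f g -> L2 f.
Proof. by case: A_lin => h _ _ _ /h[]. Qed.

Section Eigenfunctions.
Variables (lam : nat -> R[i]) (phi : nat -> F).
Hypothesis phiA : forall k, A (phi k) (fun x => lam k * phi k x).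

Lemma operator0 : A (fun=> 0) (fun=> 0).
Proof.
case: A_lin => _ _ _ /(_ (-1) _ _ _ _ (phiA 0) (phiA 0)).
by apply: operator_eq1 => x; rewrite mulN1r addNr.
Qed.

Lemma operator_eigensum (a : nat -> R[i]) N :
  A (fun x => \sum_(k < N) a k * phi k x)
    (fun x => \sum_(k < N) a k * lam k * phi k x).
Proof.
elim: N => [|N IH].
  under eq_fun do rewrite big_ord0; under [X in A _ X]eq_fun do rewrite big_ord0.
  exact: operator0.
case: A_lin => _ _ _ /(_ (a N) _ _ _ _ (phiA N) IH).
by apply: operator_eq1 => x; rewrite big_ord_recr/= addrC// mulrA.
Qed.

(** Both [0] and an eigenfunction are images of [0] under the resolvent. *)
Lemma resolvent_set_not_eigenvalue k :
  L2norm (phi k) = 1 -> ~ resolvent_set A (lam k).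
Proof.
move=> phi1 [_ uniq _].
have phi0 : aeq (phi k) (fun=> 0).
  apply: (uniq (fun=> 0)); first exact: L2_0.
    by apply: operator_eq1 (phiA k) => // x; rewrite subr0.
  by apply: operator_eq1 operator0 => // x; rewrite mulr0 subr0.
have := aeq0_L2norm (operator_L2 (phiA k)) phi0.
by rewrite phi1 => /eqP; rewrite oner_eq0.
Qed.

Variables (delta M : R).
Hypothesis M0 : 0 < M.
Hypothesis A_res : forall z, ~ sector delta z ->
  forall g f, L2 g -> resolvent A z g f ->
  L2norm f <= M / (1 + Cabs z) * L2norm g.
Hypothesis delta_pi : 0 < delta < pi / 2%:R.
Hypothesis lam0 : forall k, 0 <= Re (lam k).

Lemma eigenfunction_L2 k : L2 (phi k).
Proof. exact: operator_L2 (phiA k). Qed.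
Let phiL := eigenfunction_L2.

Lemma addr_scale_neq0 h k : 0 <= h -> 1 + h%:C * lam k != 0.
Proof.
move=> h0; apply/eqP => /(congr1 (@Re R)).
have := lam0 k; case: (lam k) => a b /= a0 /eqP.
rewrite mul0r subr0 gt_eqF//.
by have := mulr_ge0 h0 a0; lra.
Qed.

(** The implicit Euler step [(1 + h A)^-1] is the resolvent at [-1/h], up to
the factor [-1/h]; its norm is bounded independently of [h]. *)
Lemma implicit_euler_bound h (a : nat -> R[i]) N : 0 <= h ->
  L2norm (fun x => \sum_(k < N) (1 + h%:C * lam k)^-1 * a k * phi k x) <=
  (M + 1) * L2norm (fun x => \sum_(k < N) a k * phi k x).
Proof.
rewrite le_eqVlt => /predU1P[<-|h0].
  rewrite (_ : (fun x => _) = (fun x => \sum_(k < N) a k * phi k x)).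
    by rewrite ler_peMl ?L2norm_ge0// lerDr ltW.
  by apply/funext => x; apply: eq_bigr => k _; rewrite mul0r addr0 invr1 mul1r.
have gL : L2 (fun x => \sum_(k < N) a k * phi k x).
  by apply: L2_sum => k; exact: L2Z.
pose z : R[i] := (- h^-1)%:C.
have zn : ~ sector delta z.
  move=> /(sector_Re delta_pi); apply/negP; rewrite -ltNge.
  apply: (@lt_le_trans _ _ 0); first by rewrite /z /= oppr_lt0 invr_gt0.
  by rewrite mulr_ge0 ?Cabs_ge0// ltW// cos_sector_gt0.
have hC : h%:C != 0 :> R[i] by rewrite eq_complex /= eqxx andbT gt_eqF.
have := A_res zn (L2Z z gL).
move=> /(_ (fun x => \sum_(k < N) (1 + h%:C * lam k)^-1 * a k * phi k x)) res.
apply: le_trans (res _) _.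
  have := operator_eigensum (fun k => (1 + h%:C * lam k)^-1 * a k) N.
  apply: operator_eq1 => // x.
  rewrite -mulrBr -sumrB mulr_sumr; apply: eq_bigr => k _.
  rewrite /z rmorphN fmorphV; field.
  by rewrite hC addr_scale_neq0 ?(ltW h0).
rewrite L2normZ// mulrA ler_wpM2r ?L2norm_ge0// /z Cabs_real normrN.
rewrite ger0_norm ?invr_ge0 ?(ltW h0)//.
have h10 : 0 < 1 + h^-1 by rewrite addr_gt0// invr_gt0.
rewrite mulrAC ler_pdivrMr// mulrDr mulr1 mulrDl mul1r.
have : 0 < h^-1 by rewrite invr_gt0.
by move: M0 => ? ?; lra.
Qed.

Lemma implicit_euler_iter_bound h (a : nat -> R[i]) N n : 0 <= h ->
  L2norm (fun x => \sum_(k < N) (1 + h%:C * lam k)^-1 ^+ n * a k * phi k x) <=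
  (M + 1) ^+ n * L2norm (fun x => \sum_(k < N) a k * phi k x).
Proof.
move=> h0; elim: n => [|n IH].
  rewrite expr0 mul1r le_eqVlt; apply/orP; left; apply/eqP; congr L2norm.
  by apply/funext => x; apply: eq_bigr => k _; rewrite expr0 mul1r.
rewrite exprS -mulrA.
have M1 : 0 <= M + 1 by rewrite addr_ge0// ltW.
apply: le_trans (ler_wpM2l M1 IH).
apply: le_trans (implicit_euler_bound
  (fun k => (1 + h%:C * lam k)^-1 ^+ n * a k) N h0).
rewrite le_eqVlt; apply/orP; left; apply/eqP; congr L2norm.
by apply/funext => x; apply: eq_bigr => k _; rewrite exprS !mulrA.
Qed.

Variables (c : nat -> R[i]) (th gam be B : R).
Hypothesis phi1 : forall k, L2norm (phi k) = 1.
Hypothesis th0 : 0 < th.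
Hypothesis gam1 : 1 < gam.
Hypothesis c_le : forall k, Cabs (c k) <= th * k.+1%:R `^ (- gam).
Hypothesis be0 : 0 < be.
Hypothesis B0 : 0 < B.
Hypothesis lam_le : forall k, Cabs (lam k) <= B * k.+1%:R `^ be.

(** An infinite expansion [sum_k c_k phi_k] can be null without its coefficients
being so, hence its vanishing has to be propagated in time. The implicit Euler
approximations of the solution vanish, as images of this sum under bounded
operators, and they converge to the solution because the coefficients are
summable. In the proof, the rank [N0] beyond which the coefficients are
negligible is chosen first, then the number [n] of Euler steps, then the rank
[N], at which the partial sum is small compared with [(M + 1)^(- n)]. *)
Lemma null_initial_value (u0 v : F) (m t : R) :
    L2 u0 -> L2norm u0 = 0 -> L2cvg (fun N x => \sum_(k < N) c k * phi k x) u0 ->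
    L2 v -> 0 <= t ->
    L2cvg (fun N x => (expR (m * t))%:C *
      \sum_(k < N) c k * cexp (- lam k * t%:C) * phi k x) v ->
  L2norm v = 0.
Proof.
move=> u0L u00 u0cvg vL t0 vcvg.
have gam0 : 0 < gam - 1 by rewrite subr_gt0.
apply/le_anti; rewrite L2norm_ge0 andbT; apply/ler_addgt0Pr => e' e'0.
rewrite add0r; set K := expR (m * t) in vcvg *.
have K0 : 0 < K by exact: expR_gt0.
pose e := e' / (5 * K).
have e0 : 0 < e by rewrite divr_gt0// mulr_gt0.
have [N0 N00 N0_le] := exists_powRN_le gam0 (divr_gt0 (mulr_gt0 e0 gam0) th0).
have tail M' : \sum_(N0 <= k < M') Cabs (c k) <= e.
  apply: le_trans (tail_Cabs_coef_le th0 gam1 c_le _ N00) _.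
  apply: le_trans (ler_wpM2l (divr_ge0 (ltW th0) (ltW gam0)) N0_le) _.
  by rewrite le_eqVlt; apply/orP; left; apply/eqP; field; rewrite !gt_eqF.
pose W := t * (B * N0%:R `^ be).
have W0 : 0 <= W by rewrite !mulr_ge0 ?powR_ge0 ?(ltW B0).
have W_le k : (k < N0)%N -> Cabs (t%:C * lam k) <= W.
  move=> kN; rewrite CabsM Cabs_real ger0_norm// ler_wpM2l//.
  apply: le_trans (lam_le k) _; rewrite ler_wpM2l ?(ltW B0)//.
  by rewrite ge0_ler_powR ?(ltW be0) ?nnegrE// ler_nat.
pose S := th * (1 + (gam - 1)^-1).
have S0 : 0 <= S by rewrite mulr_ge0 ?(ltW th0)// addr_ge0// invr_ge0 ltW.
have C0 : 0 <= (2 * expR 1 + 1) * W ^+ 2.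
  by rewrite mulr_ge0 ?sqr_ge0// addr_ge0// mulr_ge0 ?expR_ge0.
pose Q := S * ((2 * expR 1 + 1) * W ^+ 2).
have Q0 : 0 <= Q.
  by rewrite mulr_ge0.
pose n := (Num.truncn (W + Q / e)).+1.
have n_gt : W + Q / e < n%:R by exact: truncnS_gt.
have n0 : 0 < n%:R :> R by rewrite ltr0n.
have Wn : W <= n%:R by apply/ltW/(le_lt_trans _ n_gt); rewrite lerDl divr_ge0// ltW.
have Qn : Q / n%:R <= e.
  rewrite ler_pdivrMr// mulrC -ler_pdivrMr//; apply/ltW/(le_lt_trans _ n_gt).
  by rewrite lerDr.
pose b k := (1 + (n%:R^-1 * t)%:C * lam k)^-1 ^+ n.
have h0 : 0 <= n%:R^-1 * t by rewrite mulr_ge0// invr_ge0 ltW.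
have b_le1 k : Cabs (b k) <= 1.
  rewrite CabsX ComplexField.Normc.normcV exprn_ile1 ?invr_ge0 ?Cabs_ge0//.
  have h1 : 1 <= Cabs (1 + (n%:R^-1 * t)%:C * lam k).
    apply: le_trans (Re_le_Cabs _); have := lam0 k.
    case: (lam k) => x y /= x0; rewrite mul0r subr0 lerDl.
    by rewrite mulr_ge0.
  by rewrite invf_le1// (lt_le_trans ltr01).
pose Mn := (M + 1) ^+ n.
have Mn0 : 0 < Mn by rewrite exprn_gt0// addr_gt0.
have /cvgrPdist_lt/(_ _ (divr_gt0 e0 Mn0))[N1 _ N1P] := u0cvg.
pose N := maxn N0 N1.
have sumL (a : nat -> R[i]) N' : L2 (fun x => \sum_(k < N') a k * phi k x).
  by apply: L2_sum => k; exact: L2Z.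
have SN : Mn * L2norm (fun x => \sum_(k < N) c k * phi k x) <= e.
  have := N1P N (leq_maxr _ _); rewrite /= sub0r normrN ger0_norm ?L2norm_ge0//.
  move=> h; rewrite mulrC -ler_pdivlMr//; apply: le_trans (ltW h).
  have := L2norm_triangle (L2B (sumL c N) u0L) u0L; rewrite u00 addr0.
  by under eq_fun do rewrite subrK.
have E1 : \sum_(k < N) Cabs (c k) * Cabs (cexp (- lam k * t%:C) - b k) <= e + e *+ 2.
  rewrite -(big_mkord xpredT
    (fun k => Cabs (c k) * Cabs (cexp (- lam k * t%:C) - b k))).
  rewrite (big_cat_nat (leq0n N0) (leq_maxl N0 N1))/= lerD//.
    apply: le_trans Qn; rewrite /Q -mulrA.
    apply: le_trans (_ : (\sum_(k < N0) Cabs (c k)) *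
       ((2 * expR 1 + 1) * W ^+ 2 / n%:R) <= _); last first.
      by apply: ler_wpM2r; [exact: divr_ge0 C0 (ltW n0) | exact: (sum_Cabs_coef_le th0 gam1 c_le N0)].
    rewrite big_mkord mulr_suml; apply: ler_sum => k _.
    rewrite ler_wpM2l ?Cabs_ge0// cexp_time.
    have -> : b k = (1 + n%:R^-1%:C * (t%:C * lam k))^-1 ^+ n.
      by rewrite /b rmorphM/= -mulrA.
    have tl0 : 0 <= Re (t%:C * lam k).
      by have := lam0 k; case: (lam k) => x y /= x0; rewrite mul0r subr0 mulr_ge0.
    have kW := W_le _ (ltn_ord k).
    apply: le_trans (cexp_post_widder (ltn0Sn _) tl0 (le_trans kW Wn)) _.
    rewrite ler_wpM2r ?invr_ge0 ?(ltW n0)// ler_wpM2l ?addr_ge0 ?mulr_ge0 ?expR_ge0//.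
    by rewrite lerXn2r ?nnegrE ?Cabs_ge0.
  rewrite -mulr_natr -(ler_pM2r (_ : 0 < 2^-1))// -mulrA mulfV// mulr1.
  apply: le_trans (tail N); rewrite mulr_suml !big_nat.
  apply: ler_sum => k _; rewrite -mulrA ler_piMr ?Cabs_ge0//.
  rewrite ler_pdivrMr// mul1r; apply: le_trans (CabsD _ _) _.
  by rewrite CabsN lerD// ?b_le1// Cabs_cexp_le1.
have E2 M' : \sum_(N <= k < M') Cabs (c k) <= e.
  have [NM|MN] := leqP N M'; last by rewrite big_geq ?(ltW e0)// ltnW.
  apply: le_trans (tail M'); rewrite (big_cat_nat (leq_maxl N0 N1) NM)/=.
  by rewrite lerDr sumr_ge0// => *; exact: Cabs_ge0.
have bL : L2 (fun x => K%:C * \sum_(k < N) c k * b k * phi k x).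
  by apply: L2Z; exact: (sumL (fun k => c k * b k)).
have := L2norm_triangle (L2B vL bL) bL.
under eq_fun do rewrite subrK.
move=> /le_trans; apply.
have err := expansion_error eigenfunction_L2 phi1 lam0 (b := b) vL t0 vcvg E1 E2.
have iter := implicit_euler_iter_bound c N n h0.
have {}iter : L2norm (fun x => K%:C * \sum_(k < N) c k * b k * phi k x) <= K * e.
  rewrite L2normZ; last exact: (sumL (fun k => c k * b k)).
  rewrite Cabs_real ger0_norm ?(ltW K0)// ler_wpM2l ?(ltW K0)//.
  apply: le_trans SN; apply: le_trans iter.
  rewrite le_eqVlt; apply/orP; left; apply/eqP; congr L2norm.
  by apply/funext => x; apply: eq_bigr => k _; rewrite (mulrC (c k)).
apply: le_trans (lerD err iter) _.
have -> : e' = 5 * K * e by rewrite mulrC divfK// gt_eqF// mulr_gt0.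
rewrite -/K le_eqVlt; apply/orP; left; apply/eqP; ring.
Qed.

End Eigenfunctions.

End Operators.

(** * The low-dimensional space *)

(* Below, k runs from 0: the pair (lam k, phi k) is (lambda_{k+1}, phi_{k+1}),
   whence the k.+1 in the decay and growth conditions. *)
Theorem theorem2p8 (R : realType) :
  (* C = Cst theta gamma;  kappa beta gamma = O(beta / (gamma - 1)) *)
  exists (Cst : R -> R -> R) (K : R) (kappa : R -> R -> R),
  [/\ forall theta gamma : R, 0 < theta -> 1 < gamma -> 0 < Cst theta gamma,
      0 < K,
      forall beta gamma : R, 0 < beta -> 1 < gamma ->
        0 < kappa beta gamma <= K * (beta / (gamma - 1)) &
  forall (d n : nat) (p : mindex d n -> 'rV[R]_d -> R) (delta mu T : R),
  let L := diffop p in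
  let Lmu := plus_scalar L mu in
  let beta : R := n%:R / d%:R in
  (0 < d)%N -> (0 < n)%N -> ~~ odd n ->
  (forall a, continuous (p a) /\ periodic2pi (p a)) ->
  strongly_elliptic p ->
  0 < delta < pi / 2%:R -> 0 < mu -> 0 < T ->
  admissible delta Lmu ->
  spectrum Lmu `<=` Cinterior (sector delta) ->
  (* CL kap = C_L(kap) is a constant of the approximation property of Lmu, as
     soon as that property has one. *)
  exists CL : R -> R,
    (forall kap : R, 0 < kap -> 0 < CL kap /\
       ((exists2 C : R, 0 < C & approximation_property Lmu T kap C) ->
        approximation_property Lmu T kap (CL kap))) /\
  forall (lam : nat -> R[i]) (phi : nat -> tfun R d),
  eigenpairs Lmu lam phi ->
  (exists B : R, forall k : nat, Re (lam k) <= B * k.+1%:R `^ beta) ->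
  forall (theta gamma : R) (c : nat -> R[i]) (u0 : tfun R d)
         (u : R -> tfun R d),
  0 < theta -> 1 < gamma ->
  L2 u0 ->
  L2cvg (fun N x => \sum_(k < N) c k * phi k x) u0 ->
  (forall k : nat, Cabs (c k) <= theta * k.+1%:R `^ (- gamma)) ->
  (forall t : R, 0 <= t <= T -> L2 (u t) /\
     L2cvg (fun N x => (expR (mu * t))%:C *
              \sum_(k < N) c k * cexp (- lam k * t%:C) * phi k x) (u t)) ->
  solution L T u0 u ->
  exists2 eps0 : R, 0 < eps0 & forall eps : R, 0 < eps < eps0 ->
    exists2 V : set (tfun R d),
      subspace_dim_le V (CL (kappa beta gamma) * `|ln eps| ^+ 2) &
      exists2 P : tfun R d -> tfun R d, orthogonal_projection V P &
        forall t : R, 0 <= t <= T ->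
          L2norm (fun x => u t x - P (u t) x)
          <= Cst theta gamma * eps * L2norm u0].
Proof.
exists (fun _ _ => 1), 1, (fun be gam => be / (gam - 1)); split => //.
  by move=> be gam be0 gam1; rewrite mul1r lexx andbT divr_gt0// subr_gt0.
move=> d n p delta mu T L Lmu be d0 n0 _ _ _ delta_pi mu0 T0 Lmu_adm _.
have be0 : 0 < be by rewrite divr_gt0 ?ltr0n.
have cos0 := cos_sector_gt0 delta_pi.
(* with this [q], [2 q |z| <= Re z] on the sector *)
pose q := cos delta / 2.
have q0 : 0 < q by rewrite divr_gt0.
pose D kap := ((3 + 4 * kap) / ln (1 + q) + 1) * (2 / ln 2 + 1) + 1.
have D0 kap : 0 < kap -> 0 < D kap.
  move=> kap0; rewrite addr_gt0// mulr_gt0 ?addr_gt0// divr_gt0 ?ln_gt0 ?ltr1n//.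
    by rewrite addr_gt0// mulr_gt0.
  by rewrite ltrDl.
have /choice[CL CLP] kap : exists C, 0 < kap -> D kap <= C /\
    ((exists2 C : R, 0 < C & approximation_property Lmu T kap C) ->
     approximation_property Lmu T kap C).
  have [[C C0 CP]|noC] :=
    pselect (exists2 C : R, 0 < C & approximation_property Lmu T kap C).
    exists (Num.max (D kap) C) => kap0; split; first by rewrite le_max lexx.
    by move=> _; apply: approximation_property_le CP => //; rewrite le_max lexx orbT.
  by exists (D kap).
exists CL; split => [kap kap0|].
  have [DC CA] := CLP kap kap0; split=> //.
  exact: lt_le_trans (D0 _ kap0) DC.
move=> lam phi [phiA _ _ _] [B lamB] th gam c u0 u th0 gam1 u0L u0cvg c_le ucvg _.
have kap0 : 0 < be / (gam - 1) by rewrite divr_gt0// subr_gt0.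
have [DC _] := CLP _ kap0.
have [Lmu_lin _ _ [M M0 Lmu_res]] := Lmu_adm.
have lam_sector k : cos delta * Cabs (lam k) <= Re (lam k).
  apply: (sector_Re delta_pi).
  have [phiAk phi1] := phiA k; apply: contrapT => /Lmu_res[lamres _].
  exact: (resolvent_set_not_eigenvalue Lmu_lin (fun k => (phiA k).1) phi1 lamres).
have phi1 k : L2norm (phi k) = 1 by have [] := phiA k.
have phiL := eigenfunction_L2 Lmu_lin (fun k => (phiA k).1).
have lam0 k : 0 <= Re (lam k).
  by apply: le_trans (lam_sector k); rewrite mulr_ge0 ?Cabs_ge0// ltW.
pose B' := (`|B| + 1) / cos delta.
have B'0 : 0 < B' by rewrite divr_gt0// ltr_pwDr.
have lam_le k : Cabs (lam k) <= B' * k.+1%:R `^ be.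
  rewrite /B' mulrAC ler_pdivlMr// mulrC.
  apply: le_trans (lam_sector k) (le_trans (lamB k) _).
  by rewrite ler_wpM2r ?powR_ge0// (le_trans (ler_norm B))// lerDl.
have uL t : 0 <= t <= T -> L2 (u t) by case/ucvg.
have {}ucvg t : 0 <= t <= T -> L2cvg (fun N x => (expR (mu * t))%:C *
    \sum_(k < N) c k * cexp (- lam k * t%:C) * phi k x) (u t) by case/ucvg.
(* The error is measured relatively to the norm of [u0]; a null [u0] leaves no
   room for any error. *)
have [u00|u0_neq0] := eqVneq (L2norm u0) 0.
  exists 1 => // eps _.
  have [P PP Pmin] := @exists_orthogonal_projection R d 0 (fun _ _ => 0)
    (fun i => L2_0).
  exists (L2span (fun _ : 'I_0 => fun=> 0)).
    exists 0%N, (fun _ _ => 0); split => // [|i]; last exact: L2_0.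
    by rewrite mulr_ge0 ?sqr_ge0// (le_trans (ltW (D0 _ kap0)) DC).
  exists P => // t tT; rewrite u00 mulr0.
  apply: le_trans (Pmin _ (fun=> 0) (uL t tT)) _.
  under eq_fun do rewrite big_ord0 subr0.
  have /andP[t0 _] := tT.
  rewrite (null_initial_value Lmu_lin (fun k => (phiA k).1) M0 _ delta_pi lam0
    phi1 th0 gam1 c_le be0 B'0 lam_le u0L u00 u0cvg (uL t tT) t0 (ucvg t tT))//.
  by move=> z /Lmu_res[].
have u0_gt0 : 0 < L2norm u0 by rewrite lt_def u0_neq0 L2norm_ge0.
have lowrank := low_rank_approximation phiL phi1 lam0 th0 gam1 c_le be0 B'0
  lam_le q0 (ltW mu0) _ uL ucvg.
set Cst := (X in expR (mu * T) * X) in lowrank.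
set C0 := expR (mu * T) * Cst in lowrank.
(* Respectively: [1 <= |ln eps|], [T <= 1 / eps], and the constant [C0] of the
   error [C0 eps^2] absorbed by one factor [eps]. *)
exists (Num.min (expR (-1)) (Num.min T^-1 (L2norm u0 / (`|C0| + 1)))).
  by rewrite !lt_min expR_gt0 invr_gt0 T0 divr_gt0// ltr_pwDr.
move=> eps /andP[eps0]; rewrite !lt_min => /and3P[eps_e epsT epsC].
pose ell := - ln eps.
have epsE : eps = expR (- ell) by rewrite opprK lnK.
have ell1 : 1 <= ell by rewrite -lerN2 -ler_expR -epsE ltW.
have Tell : T <= expR ell.
  by rewrite -[ell]opprK expRN -epsE -[T]invrK lef_pV2 ?posrE ?invr_gt0// ltW.
have lnE : `|ln eps| ^+ 2 = ell ^+ 2 by rewrite -normrN real_normK ?num_real.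
have [|X [v [Xle vL vapprox]]] := lowrank _ ell ell1 Tell.
  by move=> k; rewrite /q mulrCA mulfV// mulr1; exact: lam_sector.
pose w (i : 'I_#|X|) := v (enum_val i).
have wL i : L2 (w i) by exact: vL.
have [P PP Pmin] := exists_orthogonal_projection wL.
exists (L2span w).
  exists #|X|, w; split => //; rewrite lnE.
  by apply: le_trans Xle _; rewrite ler_wpM2r ?sqr_ge0.
exists P => // t tT; have [a aP] := vapprox t tT.
apply: le_trans (Pmin _ (fun i => a (enum_val i)) (uL t tT)) _.
rewrite (_ : (fun x => _) = (fun x => u t x - \sum_i a i * v i x)); last first.
  apply/funext => x; congr (_ - _).
  by rewrite [RHS](reindex _ (onW_bij _ (enum_val_bij X))).
apply: le_trans aP _; rewrite mul1r.
have -> : expR (- (2 * ell)) = eps * eps by rewrite epsE -expRD; congr expR; ring.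
rewrite -/C0 mulrCA ler_wpM2l ?(ltW eps0)//.
move: epsC; rewrite ltr_pdivlMr; last by rewrite ltr_pwDr.
move=> /ltW; apply: le_trans; rewrite mulrC ler_wpM2l ?(ltW eps0)//.
by rewrite (le_trans (ler_norm C0))// lerDl.
Qed.
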